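(* Let $T>0$, $d\ge 1$, and let $A,B,C\in L^\infty(0,T;\mathbb{R}^{d\times d})$, $Q\in L^\infty(0,T;\mathcal{S}^d)$, $G\in\mathcal{S}^d$, $D\in C([0,T];\mathbb{R}^{d\times d})$, $R\in C([0,T];\mathcal{S}^d)$. Assume that $D(t)$ is invertible for every $t\in[0,T]$ and that $G>0$. For $\alpha\in(0,1)$ let $$\lambda_\alpha(t)=\lambda_*\Bigl(\bigl[A^\top+A+C^\top C-(1-\alpha)^{-1}(B+C^\top D)(D^\top D)^{-1}(B^\top+D^\top C)\bigr](t)\Bigr),$$ and let $\varphi_\alpha$ be the solution on $[0,T]$ of the scalar linear ODE $$\dot\varphi_\alpha(t)+\lambda_\alpha(t)\varphi_\alpha(t)+\alpha\,\lambda_*(Q(t))=0,\qquad \varphi_\alpha(T)=\alpha\,\lambda_*(G).$$ Suppose that for some $\alpha\in(0,1)$ one has $\varphi_\alpha(t)>0$ and $R(t)\ge-\varphi_\alpha(t)D(t)^\top D(t)$ for all $t\in[0,T]$. Then the Riccati problem $$\dot P+A^\top P+PA+C^\top PC+Q=(PB+C^\top PD)(R+D^\top PD)^{-1}(PB+C^\top PD)^\top,\qquad P(T)=G,$$ $$R+D^\top PD>0\quad\text{over }[0,T],$$ admits a unique solution $P$ over $[0,T]$.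
   Context: $\mathcal{S}^d$ is the set of real symmetric $d\times d$ matrices with the usual semi-order: $M\ge N$ (resp. $M>N$) means that $M-N$ is positive semidefinite (resp. positive definite). Inequalities between matrix functions are pointwise in time (almost everywhere for $L^\infty$ functions). $\lambda_*(M)$ denotes the minimal eigenvalue of a symmetric matrix $M$. A solution of an ODE on $[0,T]$ with $L^\infty$ coefficients is an absolutely continuous function satisfying the equation for almost every $t$ together with the terminal condition. A solution $P$ of the Riccati problem takes values in $\mathcal{S}^d$ and satisfies the constraint $R(t)+D(t)^\top P(t)D(t)>0$ for every $t\in[0,T]$. *)

(* Defs.v *)
From HB Require Import structures.
From mathcomp Require Import all_boot all_order all_algebra.
From mathcomp Require Import all_classical all_reals all_analysis.

Set Implicit Arguments.
Unset Strict Implicit.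
Unset Printing Implicit Defensive.

Import Order.TTheory GRing.Theory Num.Theory.
Import numFieldNormedType.Exports.

Local Open Scope classical_set_scope.
Local Open Scope ring_scope.

Definition posdefmx (K : realType) (d : nat) (M : 'M[K]_d) : Prop :=
  M \is symmetricmx /\
  forall x : 'cV[K]_d, x != 0 -> 0 < (x^T *m M *m x) ord0 ord0.

Definition possemidefmx (K : realType) (d : nat) (M : 'M[K]_d) : Prop :=
  M \is symmetricmx /\
  forall x : 'cV[K]_d, 0 <= (x^T *m M *m x) ord0 ord0.

Definition loewner_le (K : realType) (d : nat) (N M : 'M[K]_d) : Prop :=
  possemidefmx (M - N).

(* For a symmetric M of size d >= 1 the set of real eigenvalues is finite and
   nonempty, so that this infimum is its minimum. *)
Definition min_eigenvalue (K : realType) (d : nat) (M : 'M[K]_d) : K :=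
  inf [set a | eigenvalue M a].

(* Functions on [0, T] are represented by total functions on K, of which only
   the values at points of [0, T] matter. *)
Definition ae_on (K : realType) (T : K) (E : K -> Prop) : Prop :=
  {ae (@lebesgue_measure K), forall t : K, t \in `[0, T] -> E t}.

Definition Linfty_mx (K : realType) (T : K) (d : nat) (M : K -> 'M[K]_d) :
    Prop :=
  (forall i j, measurable_fun `[0, T] (fun t => M t i j)) /\
  exists c : K, ae_on T (fun t => forall i j, `|M t i j| <= c).

Definition abs_continuous (K : realType) (V : normedModType K) (T : K)
    (f : K -> V) : Prop :=
  forall e : K, 0 < e -> exists2 r : K, 0 < r &
    forall (n : nat) (a b : 'I_n -> K),
      (forall i, 0 <= a i /\ a i <= b i /\ b i <= T) ->
      trivIset [set: 'I_n] (fun i => `]a i, b i[%classic) ->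
      \sum_(i < n) (b i - a i) < r ->
      \sum_(i < n) `|f (b i) - f (a i)| < e.

(* The differential equation f' + F(t, f) = 0 on [0, T] with f(T) = fT. *)
Definition ode_solution (K : realType) (V : normedModType K) (T : K)
    (F : K -> V -> V) (fT : V) (f : K -> V) : Prop :=
  [/\ abs_continuous T f,
      ae_on T (fun t => derivable f t 1 /\ 'D_1 f t + F t (f t) = 0) &
      f T = fT].

Definition lambda_alpha (K : realType) (d : nat) (A B C D : K -> 'M[K]_d)
    (alpha t : K) : K :=
  min_eigenvalue
    ((A t)^T + A t + (C t)^T *m C t
     - (1 - alpha)^-1 *:
         ((B t + (C t)^T *m D t) *m invmx ((D t)^T *m D t)
          *m ((B t)^T + (D t)^T *m C t))).

Definition phi_solution (K : realType) (d : nat) (T : K)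
    (A B C D Q : K -> 'M[K]_d) (G : 'M[K]_d) (alpha : K) (phi : K -> K) : Prop :=
  @ode_solution K K T
    (fun t x => lambda_alpha A B C D alpha t * x + alpha * min_eigenvalue (Q t))
    (alpha * min_eigenvalue G) phi.

(* The right-hand side of the Riccati equation is moved to the left. *)
Definition riccati_solution (K : realType) (d : nat) (T : K)
    (A B C D Q R : K -> 'M[K]_d) (G : 'M[K]_d) (P : K -> 'M[K]_d) : Prop :=
  [/\ forall t, t \in `[0, T] -> P t \is symmetricmx,
      ode_solution T
        (fun t X => (A t)^T *m X + X *m A t + (C t)^T *m X *m C t + Q t
           - (X *m B t + (C t)^T *m X *m D t)
             *m invmx (R t + (D t)^T *m X *m D t)
             *m (X *m B t + (C t)^T *m X *m D t)^T)
        G P &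
      forall t, t \in `[0, T] -> posdefmx (R t + (D t)^T *m P t *m D t)].

(* Main.v *)
(** Existence comes from Kleinman's iteration. Put [psi = phi / alpha]. Completing
    the square in the control shows that [psi(t) I] is a subsolution of the
    Riccati equation, and even of every linear Lyapunov equation obtained by
    freezing a feedback [L]; the hypothesis on [R] makes [R + D^T X D] uniformly
    coercive over all [X >= psi I]. Starting from [psi I], let [P_(n+1)] solve the
    Lyapunov equation whose feedback is the optimal one for [P_n]. Positivity of
    linear Lyapunov equations gives [psi I <= P_(n+2) <= P_(n+1)] for all [n], so
    that the iterates converge pointwise and, by dominated convergence, the limit
    solves the Riccati equation. Uniqueness is the same comparison applied in
    both directions to two solutions. *)

Require Import Defs.
From mathcomp Require Import all_boot all_order all_algebra.
From mathcomp Require Import all_classical all_reals all_analysis.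
From mathcomp Require Import measurable_realfun ring lra.

Set Implicit Arguments.
Unset Strict Implicit.
Unset Printing Implicit Defensive.

Import Order.TTheory GRing.Theory Num.Theory.
Import numFieldNormedType.Exports.

Local Open Scope classical_set_scope.
Local Open Scope ring_scope.

(** * Quadratic forms *)

(** [R] carries no sign, so [R + D^T X D] can be singular for general [X]; the iteration must stay
    where this weight is invertible, with one bound for all iterates. The number [alpha] splits
    [psi |D u|^2] in two. The share [alpha] pays for the negative part of [R], since
    [phi = alpha psi]. The share [1 - alpha] serves twice: it absorbs the cross term in [u], whence
    the factor [(1 - alpha)^-1] in [lambda_alpha], and it is the coercivity left in the weight. The
    starting point lies below the limit while all later iterates lie above it: the descent argument
    compares solutions of Lyapunov equations, and such solutions appear only from [P_1] on. The
    coefficients are merely bounded and measurable, so derivatives exist almost everywhere.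
    Comparisons therefore rest on a monotonicity theorem for absolutely continuous functions, linear
    equations are solved in integral form, and coefficients are first set to [0] on a null set so
    that bounds hold at every time. *)

Section QuadraticForms.
Context {K : realType} {d : nat}.
Implicit Types (M N E X : 'M[K]_d) (x y z : 'cV[K]_d) (a b c : K).

Definition bil M x y : K := (x^T *m M *m y) ord0 ord0.

Lemma bilDm M N x y : bil (M + N) x y = bil M x y + bil N x y.
Proof. by rewrite /bil mulmxDr mulmxDl mxE. Qed.

Lemma bilNm M x y : bil (- M) x y = - bil M x y.
Proof. by rewrite /bil mulmxN mulNmx mxE. Qed.

Lemma bilBm M N x y : bil (M - N) x y = bil M x y - bil N x y.
Proof. by rewrite bilDm bilNm. Qed.

Lemma bilZm a M x y : bil (a *: M) x y = a * bil M x y.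
Proof. by rewrite /bil -scalemxAr -scalemxAl mxE. Qed.

Lemma bilDl M x y z : bil M (x + y) z = bil M x z + bil M y z.
Proof. by rewrite /bil linearD /= !mulmxDl mxE. Qed.

Lemma bilDr M x y z : bil M x (y + z) = bil M x y + bil M x z.
Proof. by rewrite /bil mulmxDr mxE. Qed.

Lemma bilZl a M x y : bil M (a *: x) y = a * bil M x y.
Proof. by rewrite /bil linearZ /= -!scalemxAl mxE. Qed.

Lemma bilZr a M x y : bil M x (a *: y) = a * bil M x y.
Proof. by rewrite /bil -scalemxAr mxE. Qed.

Lemma bilNl M x y : bil M (- x) y = - bil M x y.
Proof. by rewrite -scaleN1r bilZl mulN1r. Qed.

Lemma bilNr M x y : bil M x (- y) = - bil M x y.
Proof. by rewrite -scaleN1r bilZr mulN1r. Qed.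

Lemma bil0l M x : bil M 0 x = 0.
Proof. by rewrite -(scale0r 0) bilZl mul0r. Qed.

Lemma bil0r M x : bil M x 0 = 0.
Proof. by rewrite -(scale0r 0) bilZr mul0r. Qed.

Lemma bilMr M N x y : bil (M *m N) x y = bil M x (N *m y).
Proof. by rewrite /bil !mulmxA. Qed.

Lemma bilMl M N x y : bil (M^T *m N) x y = bil N (M *m x) y.
Proof. by rewrite /bil trmx_mul !mulmxA. Qed.

Lemma bil_congr M X N x y : bil (M^T *m X *m N) x y = bil X (M *m x) (N *m y).
Proof. by rewrite bilMr bilMl. Qed.

Lemma bil_tr M x y : bil M^T x y = bil M y x.
Proof.
rewrite /bil -[in RHS](trmxK (y^T *m M *m x)) [in RHS]mxE.
by rewrite !trmx_mul trmxK mulmxA.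
Qed.

Lemma bil_sym M x y : M^T = M -> bil M x y = bil M y x.
Proof. by move=> Ms; rewrite -bil_tr Ms. Qed.

Lemma bil1_sym x y : bil 1%:M x y = bil 1%:M y x.
Proof. by apply: bil_sym; exact: trmx1. Qed.

Lemma bil1r M x y : bil M x y = bil 1%:M x (M *m y).
Proof. by rewrite -bilMr mul1mx. Qed.

Lemma bil_scalar a x y : bil a%:M x y = a * bil 1%:M x y.
Proof. by rewrite -[a%:M]scalemx1 bilZm. Qed.

Lemma bilE M x y : bil M x y = \sum_i \sum_j x i ord0 * M i j * y j ord0.
Proof.
rewrite /bil mxE exchange_big /=; apply: eq_bigr => j _.
by rewrite mxE mulr_suml; apply: eq_bigr => i _; rewrite mxE.
Qed.

Lemma bil1E x : bil 1%:M x x = \sum_i x i ord0 ^+ 2.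
Proof.
rewrite /bil mulmx1 mxE; apply: eq_bigr => i _.
by rewrite mxE expr2.
Qed.

Lemma bil1_ge0 x : 0 <= bil 1%:M x x.
Proof. by rewrite bil1E sumr_ge0 // => i _; exact: sqr_ge0. Qed.

Lemma bil1_eq0 x : (bil 1%:M x x == 0) = (x == 0).
Proof.
apply/idP/eqP => [|->]; last by rewrite bil0l.
rewrite bil1E psumr_eq0 => [/allP x0|i _]; last exact: sqr_ge0.
apply/colP => i; rewrite mxE; apply/eqP; rewrite -sqrf_eq0.
by apply: (implyP (x0 i _)) => //; rewrite mem_index_enum.
Qed.

Lemma bil1_gt0 x : x != 0 -> 0 < bil 1%:M x x.
Proof. by move=> x0; rewrite lt_neqAle eq_sym bil1_eq0 x0 bil1_ge0. Qed.

Lemma sqr_le_bil1 x i : x i ord0 ^+ 2 <= bil 1%:M x x.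
Proof.
by rewrite bil1E (bigD1 i) //= lerDl sumr_ge0 // => j _; exact: sqr_ge0.
Qed.

Lemma bil_delta M i j : bil M (delta_mx i ord0) (delta_mx j ord0) = M i j.
Proof.
rewrite /bil trmx_delta -rowE mxE (bigD1 j) //= big1 ?addr0 => [|k kj].
  by rewrite !mxE !eqxx mulr1.
by rewrite !mxE (negPf kj) mulr0.
Qed.

Lemma bil1_delta i : bil 1%:M (delta_mx i ord0) (delta_mx i ord0) = 1.
Proof. by rewrite bil_delta mxE eqxx. Qed.

(** Each product is at most [c (x_i^2 + y_j^2)], and summing over the free index gives the factor
    [d]. The constants [c * d * 2] of later estimates are the case [y = x]. *)
Lemma bil_norm_le M c x y : (forall i j, `|M i j| <= c) ->
  `|bil M x y| <= c * d%:R * (bil 1%:M x x + bil 1%:M y y).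
Proof.
move=> Mc; rewrite bilE.
have H i j : `|x i ord0 * M i j * y j ord0| <= c * (x i ord0 ^+ 2 + y j ord0 ^+ 2).
  rewrite !normrM mulrAC mulrC.
  have c0 : 0 <= c := le_trans (normr_ge0 _) (Mc i j).
  apply: ler_pM; rewrite ?mulr_ge0 //.
  rewrite -(real_normK (num_real (x i ord0))) -(real_normK (num_real (y j ord0))).
  nra.
rewrite (le_trans (ler_norm_sum _ _ _)) //.
apply: (@le_trans _ _ (\sum_i \sum_j c * (x i ord0 ^+ 2 + y j ord0 ^+ 2))).
  apply: ler_sum => i _; rewrite (le_trans (ler_norm_sum _ _ _)) //.
  by apply: ler_sum => j _.
under eq_bigr do rewrite -mulr_sumr big_split /= sumr_const card_ord -bil1E.
rewrite -mulr_sumr big_split /= sumr_const card_ord sumrMnl -bil1E -mulrnDl.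
by rewrite -[_ *+ d]mulr_natl mulrA.
Qed.

Lemma symmetricmxP M : reflect (M^T = M) (M \is symmetricmx).
Proof.
apply: (iffP (is_hermitianmxP _ _ _)); rewrite expr0 scale1r map_mx_id //.
Qed.

Lemma psd_sym M : possemidefmx M -> M^T = M.
Proof. by case=> /symmetricmxP. Qed.

Lemma psd_ge0 M x : possemidefmx M -> 0 <= bil M x x.
Proof. by case=> _; apply. Qed.

Lemma psd0 : possemidefmx (0 : 'M[K]_d).
Proof.
split; first by apply/symmetricmxP; rewrite trmx0.
by move=> x; rewrite mulmx0 mul0mx mxE.
Qed.

Lemma posdef_psd M : posdefmx M -> possemidefmx M.
Proof.
case=> Ms Mp; split=> // x; have [->|/Mp/ltW//] := eqVneq x 0.
by rewrite mulmx0 mxE.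
Qed.

Lemma psd_cauchy M x y : possemidefmx M ->
  bil M x y ^+ 2 <= bil M x x * bil M y y.
Proof.
move=> Mp; have Ms := psd_sym Mp.
have H s t : 0 <= s ^+ 2 * bil M x x + 2 * s * t * bil M x y + t ^+ 2 * bil M y y.
  have := psd_ge0 (s *: x + t *: y) Mp.
  rewrite !(bilDl, bilDr, bilZl, bilZr) (bil_sym y x Ms).
  by congr (0 <= _); ring.
have x0 := psd_ge0 x Mp; have y0 := psd_ge0 y Mp.
have [xx0|xx0] := eqVneq (bil M x x) 0.
  have [->|B0] := eqVneq (bil M x y) 0; first by rewrite expr0n mulr_ge0.
  (* With [x^T M x = 0] the form is affine in [s]; this [s] is tuned to give the impossible value
     [-1]. *)
  have := H (- (bil M y y + 1) / (2 * bil M x y)) 1.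
  set r := - (bil M y y + 1) / (2 * bil M x y).
  have -> : r ^+ 2 * bil M x x + 2 * r * 1 * bil M x y + 1 ^+ 2 * bil M y y = - 1.
    by rewrite xx0 /r; field.
  by rewrite oppr_ge0 ler10.
(* Here the form equals [x^T M x] times the gap in the inequality, and the positive factor is
   divided out. *)
have := H (bil M x y) (- bil M x x).
have -> : bil M x y ^+ 2 * bil M x x + 2 * bil M x y * - bil M x x * bil M x y +
  (- bil M x x) ^+ 2 * bil M y y =
  bil M x x * (bil M x x * bil M y y - bil M x y ^+ 2) by ring.
by rewrite pmulr_rge0 ?subr_ge0 // lt_neqAle eq_sym xx0.
Qed.

(** Cauchy-Schwarz for [M] at the pair [M x], [x] bounds [|M x|^4] by a multiple of [x^T M x]. *)
Lemma psd_ker M x : possemidefmx M -> bil M x x = 0 -> M *m x = 0.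
Proof.
move=> Mp x0; apply/eqP; rewrite -bil1_eq0 -sqrf_eq0 -bilMr mul1mx.
rewrite eq_le sqr_ge0 andbT (le_trans (psd_cauchy _ _ Mp)) //.
by rewrite x0 mulr0.
Qed.

(** Positivity at [e_i + e_j] and [e_i - e_j] bounds [|M i j|] by the mean of two diagonal entries.
    Control of the diagonal is what a decreasing sequence of quadratic forms provides. *)
Lemma psd_entry_le M c i j : possemidefmx M -> (forall i, M i i <= c) ->
  `|M i j| <= c.
Proof.
move=> Mp Mc; have Mji : M j i = M i j by rewrite -{1}(psd_sym Mp) mxE.
have := psd_ge0 (delta_mx i ord0 + delta_mx j ord0) Mp.
have := psd_ge0 (delta_mx i ord0 - delta_mx j ord0) Mp.
rewrite !(bilDl, bilDr, bilNl, bilNr) !bil_delta Mji.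
have := Mc i; have := Mc j; rewrite ler_norml => *; apply/andP; split; lra.
Qed.

Lemma polarization M i j : M^T = M ->
  M i j = 2^-1 * (bil M (delta_mx i ord0 + delta_mx j ord0)
                       (delta_mx i ord0 + delta_mx j ord0)
    - bil M (delta_mx i ord0) (delta_mx i ord0)
    - bil M (delta_mx j ord0) (delta_mx j ord0)).
Proof.
move=> Ms; have Mji : M j i = M i j by rewrite -{1}Ms mxE.
by rewrite !(bilDl, bilDr) !bil_delta Mji; field.
Qed.

Lemma posdef_unitmx M : posdefmx M -> M \in unitmx.
Proof.
move=> [Ms Mp]; rewrite -row_free_unit -kermx_eq0; apply/eqP/row_matrixP => i.
rewrite row0; apply/eqP; apply: contraT => k0.
have := Mp (row i (kermx M))^T; rewrite trmx_eq0 => /(_ k0).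
by rewrite trmxK -row_mul mulmx_ker row0 mul0mx mxE ltxx.
Qed.

Lemma mx_entries_bounded M : exists2 c, 0 < c & forall i j, `|M i j| <= c.
Proof.
exists (\sum_i \sum_j `|M i j| + 1) => [|i j].
  by rewrite ltr_wpDl // sumr_ge0 // => i _; rewrite sumr_ge0.
rewrite (bigD1 i) //= (bigD1 j) //= -!addrA lerDl.
rewrite !addr_ge0 // sumr_ge0 // => k _; rewrite sumr_ge0 //.
Qed.

(* Coercivity without compactness: with [y := M^-1 x] the Cauchy-Schwarz
   inequality for the form [M] reads [|x|^4 <= (x^T M^-1 x) (x^T M x)]. *)
Lemma posdef_coercive M : posdefmx M ->
  exists2 e, 0 < e & forall x, e * bil 1%:M x x <= bil M x x.
Proof.
move=> Mp; have Mu := posdef_unitmx Mp; have Mpsd := posdef_psd Mp.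
have [c c0 Mc] := mx_entries_bounded (invmx M).
pose k := c * d%:R * 2 + 1.
have k0 : 0 < k by rewrite ltr_wpDl // !mulr_ge0 // ltW.
exists k^-1; first by rewrite invr_gt0.
move=> x; have [->|xn0] := eqVneq x 0; first by rewrite !bil0l mulr0.
pose y := invmx M *m x.
have My : M *m y = x by rewrite /y mulmxA mulmxV // mul1mx.
have := psd_cauchy y x Mpsd.
rewrite (bil_sym y x (psd_sym Mpsd)) [bil M x y]bil1r [bil M y y]bil1r My.
rewrite [bil _ y x]bil1_sym -(bil1r (invmx M)).
move=> CS; have x0 := bil1_gt0 xn0.
have Mx0 := psd_ge0 x Mpsd.
have Mi : bil (invmx M) x x <= k * bil 1%:M x x.
  have := bil_norm_le x x Mc => /(le_trans (ler_norm _)) H.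
  by apply: (le_trans H); rewrite /k; nra.
rewrite ler_pdivrMl //.
have : bil 1%:M x x ^+ 2 <= k * bil 1%:M x x * bil M x x.
  by rewrite (le_trans CS) // ler_wpM2r.
by rewrite -[in X in _ -> X](ler_pM2l x0) -expr2 mulrA [_ * k]mulrC.
Qed.

Lemma coercive_posdef M e : M^T = M -> 0 < e ->
  (forall x, e * bil 1%:M x x <= bil M x x) -> posdefmx M.
Proof.
move=> Ms e0 Me; split; first exact/symmetricmxP.
by move=> x x0; apply: lt_le_trans (Me x); rewrite mulr_gt0 // bil1_gt0.
Qed.

(** With [y = M^-1 e_j], coercivity reads [e |y|^2 <= y_j <= |y|], hence [|y| <= e^-1]. The bound
    depends on [e] alone, which makes the gains uniformly bounded along the iteration. *)
Lemma coercive_invmx_bound M e i j : M \in unitmx -> 0 < e ->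
  (forall x, e * bil 1%:M x x <= bil M x x) -> `|invmx M i j| <= e^-1.
Proof.
move=> Mu e0 Me.
pose y : 'cV[K]_d := invmx M *m delta_mx j ord0.
have yi : invmx M i j = y i ord0.
  by rewrite -(bil_delta (invmx M)) /bil -mulmxA -/y trmx_delta -rowE mxE.
have My : bil M y y = y j ord0.
  rewrite bil1r mulmxA mulmxV // mul1mx bil1_sym /bil mulmx1 trmx_delta.
  by rewrite -rowE mxE.
have := Me y; rewrite My => H.
have H1 := sqr_le_bil1 y j; have H2 := sqr_le_bil1 y i.
have ee : e * e^-1 = 1 by rewrite divff // gt_eqF.
have ei0 : 0 < e^-1 by rewrite invr_gt0.
have H3 : e * (e * bil 1%:M y y) <= 1.
  have := sqr_ge0 (e * y j ord0 - 1); nra.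
rewrite yi -sqrtr_sqr -(ger0_norm (ltW ei0)) -sqrtr_sqr ler_wsqrtr //.
rewrite (le_trans H2) // -(ler_pM2l e0) -(ler_pM2l e0) (le_trans H3) //.
by rewrite le_eqVlt; apply/orP; left; apply/eqP; field; rewrite gt_eqF.
Qed.

Lemma completing_square E x w : E^T = E -> E \in unitmx ->
  bil E x x + 2 * bil 1%:M w x =
  bil E (x + invmx E *m w) (x + invmx E *m w) - bil (invmx E) w w.
Proof.
move=> Es Eu; set v := invmx E *m w.
have wE : w = E *m v by rewrite /v mulmxA mulmxV // mul1mx.
have -> : bil (invmx E) w w = bil E v v.
  by rewrite bil1r -/v [in LHS]wE bil1_sym -bil1r.
have -> : bil 1%:M w x = bil E x v by rewrite wE bil1_sym -bil1r.
by rewrite !(bilDl, bilDr) (bil_sym v x Es); ring.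
Qed.

End QuadraticForms.

(** * The least eigenvalue as a lower bound of the quadratic form *)

Section Rayleigh.
Context {K : realType} {d : nat}.
Implicit Types (M N E : 'M[K]_d) (x y z u w : 'cV[K]_d) (a b c : K).


(* The largest [m] with [m |x|^2 <= x^T M x] is an eigenvalue: otherwise
   [M - m I] would be positive definite, hence coercive, and [m] could be
   increased. *)
Lemma min_eigenvalue_le M x : (0 < d)%N -> M^T = M ->
  min_eigenvalue M * bil 1%:M x x <= bil M x x.
Proof.
move=> d0 Ms; pose e0 : 'cV[K]_d := delta_mx (Ordinal d0) ord0.
have e01 : bil 1%:M e0 e0 = 1 by exact: bil1_delta.
pose S := [set a | forall x, a * bil 1%:M x x <= bil M x x].
have [c c0 Mc] := mx_entries_bounded M.
have hS : has_sup S.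
  split; last by exists (bil M e0 e0) => a /(_ e0); rewrite e01 mulr1.
  exists (- (c * d%:R * 2)) => y.
  have := bil_norm_le y y Mc; rewrite ler_norml => /andP[+ _].
  by apply: le_trans; rewrite le_eqVlt; apply/orP; left; apply/eqP; ring.
pose m := sup S.
have mS : S m.
  move=> y; have [->|y0] := eqVneq y 0; first by rewrite !bil0l mulr0.
  rewrite -ler_pdivlMr ?bil1_gt0 //; apply: ge_sup; first by case: hS.
  by move=> a /(_ y); rewrite ler_pdivlMr ?bil1_gt0.
have shiftE a y : bil (M - a%:M) y y = bil M y y - a * bil 1%:M y y.
  by rewrite bilBm bil_scalar.
have shift_sym : (M - m%:M)^T = M - m%:M by rewrite linearB /= Ms tr_scalar_mx.
have shift_psd : possemidefmx (M - m%:M).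
  split; first exact/symmetricmxP.
  by move=> y; have := mS y; rewrite -subr_ge0 -shiftE.
have [y y0 My] : exists2 y, y != 0 & bil (M - m%:M) y y = 0.
  apply: contrapT => H.
  have /posdef_coercive[e e_gt0 He] : posdefmx (M - m%:M).
    split; first exact/symmetricmxP.
    move=> y y0; have := psd_ge0 y shift_psd.
    rewrite le_eqVlt => /predU1P[yy|//].
    by exfalso; apply: H; exists y.
  have : S (m + e).
    by move=> y; have := He y; rewrite shiftE mulrDl; lra.
  by move=> /(sup_upper_bound hS); rewrite leNgt ltrDl e_gt0.
have eig a : eigenvalue M a -> m <= a.
  move=> /eigenvalueP[v vM v0].
  have vT0 : v^T != 0 by rewrite trmx_eq0.
  have := mS v^T; have -> : bil M v^T v^T = a * bil 1%:M v^T v^T.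
    by rewrite /bil trmxK vM mulmx1 -scalemxAl mxE.
  by rewrite ler_pM2r // bil1_gt0.
have eig_m : eigenvalue M m.
  apply/eigenvalueP; exists y^T; last by rewrite trmx_eq0.
  have := psd_ker shift_psd My; rewrite mulmxBl mul_scalar_mx => /eqP.
  rewrite subr_eq0 => /eqP/(congr1 trmx); rewrite trmx_mul Ms => ->.
  by rewrite linearZ.
suff -> : min_eigenvalue M = m by exact: mS.
apply/eqP; rewrite eq_le; apply/andP; split.
  by apply: ge_inf => //; exists m => a /= /eig.
by apply: lb_le_inf; [exists m|move=> a /= /eig].
Qed.

End Rayleigh.

(** * Algebra of the Riccati equation *)

Section RiccatiAlgebra.
Context {K : realType} {d : nat}.
Implicit Types (A B C D Q R X Y M N E U V L : 'M[K]_d) (x y z u w : 'cV[K]_d) (a b c : K).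

Definition lyapunov U V X := U^T *m X + X *m U + V^T *m X *m V.

Definition ric_weight D R X := R + D^T *m X *m D.

Definition ric_cross B C D X := X *m B + C^T *m X *m D.

Definition riccati A B C D Q R X :=
  A^T *m X + X *m A + C^T *m X *m C + Q
  - ric_cross B C D X *m invmx (ric_weight D R X) *m (ric_cross B C D X)^T.

Definition gain B C D R X := - (invmx (ric_weight D R X) *m (ric_cross B C D X)^T).

(** The generator of the linear equation for the cost of the feedback [u = L x]. It is affine in
    [X], so its terminal value problem is globally solvable. *)
Definition closed_loop A B C D Q R L X :=
  lyapunov (A + B *m L) (C + D *m L) X + (Q + L^T *m R *m L).

(* [x^T (-P') x] when the control [u] is applied in the state [x]; the Riccati
   operator is its minimum over [u]. *)
Definition hamiltonian A B C D Q R X x u :=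
  2 * bil X x (A *m x + B *m u) + bil X (C *m x + D *m u) (C *m x + D *m u)
  + bil Q x x + bil R u u.

Lemma lyapunov_sym U V X : X^T = X -> (lyapunov U V X)^T = lyapunov U V X.
Proof.
move=> Xs; rewrite /lyapunov !linearD /= !trmx_mul !trmxK Xs mulmxA.
by rewrite [X *m U + _]addrC.
Qed.

Lemma bil_lyapunov U V X x : X^T = X ->
  bil (lyapunov U V X) x x = 2 * bil X x (U *m x) + bil X (V *m x) (V *m x).
Proof.
move=> Xs; rewrite /lyapunov !bilDm bil_congr bilMl bilMr (bil_sym (U *m x) x Xs); ring.
Qed.

Lemma bil_closed_loop A B C D Q R L X x : X^T = X ->
  bil (closed_loop A B C D Q R L X) x x = hamiltonian A B C D Q R X x (L *m x).
Proof.
move=> Xs; rewrite /closed_loop bilDm bil_lyapunov // bilDm bil_congr !mulmxDl.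
by rewrite /hamiltonian !mulmxA addrA.
Qed.

(** The Hamiltonian is quadratic in [u] with critical point at the gain, and removing the square
    leaves the critical value. Since [u] is free, inserting the gain of another matrix measures the
    loss caused by a foreign feedback. *)
Lemma bil_riccati A B C D Q R X x u : X^T = X -> R^T = R ->
  ric_weight D R X \in unitmx ->
  bil (riccati A B C D Q R X) x x =
  hamiltonian A B C D Q R X x u
  - bil (ric_weight D R X) (u - gain B C D R X *m x) (u - gain B C D R X *m x).
Proof.
move=> Xs Rs Wu; set W := ric_weight D R X.
have Ws : W^T = W.
  by rewrite /W /ric_weight linearD /= Rs !trmx_mul trmxK Xs mulmxA.
set S := ric_cross B C D X; set w := S^T *m x.
have SQ := completing_square u w Ws Wu.
have E1 : bil 1%:M w u = bil X x (B *m u) + bil X (C *m x) (D *m u).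
  by rewrite bil1_sym -bil1r bil_tr bilDm bil_congr bilMr.
have E2 : bil (S *m invmx W *m S^T) x x = bil (invmx W) w w.
  by rewrite -{1}[S]trmxK bil_congr.
have E3 : bil W u u = bil R u u + bil X (D *m u) (D *m u).
  by rewrite bilDm bil_congr.
have E4 : bil (riccati A B C D Q R X) x x =
    2 * bil X x (A *m x) + bil X (C *m x) (C *m x) + bil Q x x - bil (invmx W) w w.
  rewrite /riccati -/W -/S bilBm E2 !bilDm bil_congr bilMl bilMr.
  by rewrite (bil_sym (A *m x) x Xs); ring.
have E5 : hamiltonian A B C D Q R X x u =
    2 * bil X x (A *m x) + 2 * bil X x (B *m u) + bil X (C *m x) (C *m x)
    + 2 * bil X (C *m x) (D *m u) + bil X (D *m u) (D *m u) + bil Q x x + bil R u u.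
  by rewrite /hamiltonian !(bilDl, bilDr) (bil_sym (D *m u) (C *m x) Xs); ring.
have -> : u - gain B C D R X *m x = u + invmx W *m w.
  by rewrite /gain mulNmx opprK -mulmxA.
by move: SQ; rewrite E1 E3 E4 E5; lra.
Qed.

Lemma gain_minimizes A B C D Q R X x u : X^T = X -> R^T = R ->
  posdefmx (ric_weight D R X) ->
  hamiltonian A B C D Q R X x (gain B C D R X *m x) <= hamiltonian A B C D Q R X x u.
Proof.
move=> Xs Rs Wp; have Wu := posdef_unitmx Wp.
have := bil_riccati A B C Q x u Xs Rs Wu.
have := bil_riccati A B C Q x (gain B C D R X *m x) Xs Rs Wu.
rewrite subrr bil0l subr0 => <- ->.
by rewrite lerBlDr lerDl psd_ge0 //; exact: posdef_psd.
Qed.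

Lemma bil_inj M N : (forall x y, bil M x y = bil N x y) -> M = N.
Proof. by move=> MN; apply/matrixP => i j; rewrite -!bil_delta MN. Qed.

(** [bil_riccati] only sees the diagonal, so the matrices are compared at pairs [x], [y]. Since
    [W L = - S^T], the terms [S L], its transpose and [S W^-1 S^T] all reduce, up to sign, to
    [L^T W L]. *)
Lemma riccati_closed_loop A B C D Q R X : X^T = X -> R^T = R ->
  ric_weight D R X \in unitmx ->
  riccati A B C D Q R X = closed_loop A B C D Q R (gain B C D R X) X.
Proof.
move=> Xs Rs Wu; apply: bil_inj => x y.
rewrite /riccati /closed_loop.
set S := ric_cross B C D X; set W := ric_weight D R X; set L := gain B C D R X.
have Ws : W^T = W.
  by rewrite /W /ric_weight linearD /= Rs !trmx_mul trmxK Xs mulmxA.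
have WL z : W *m (L *m z) = - (S^T *m z).
  by rewrite mulmxA mulmxN mulmxA mulmxV // mul1mx mulNmx.
have SL z z' : bil S z (L *m z') = - bil W (L *m z) (L *m z').
  have STz : S^T *m z = - (W *m (L *m z)) by rewrite WL opprK.
  by rewrite -bil_tr bil1r STz bilNr -bil1r bil_sym.
have SE z z' : bil S z z' = bil X z (B *m z') + bil X (C *m z) (D *m z').
  by rewrite bilDm bil_congr bilMr.
have WE z z' : bil W z z' = bil R z z' + bil X (D *m z) (D *m z').
  by rewrite bilDm bil_congr.
have SWS : bil (S *m invmx W *m S^T) x y = bil W (L *m x) (L *m y).
  have -> : S *m invmx W *m S^T = - (S *m L) by rewrite mulmxN opprK mulmxA.
  by rewrite bilNm bilMr SL opprK.
have := SL x y; have := SL y x.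
rewrite bilBm SWS (bil_sym (L *m y) _ Ws) !SE WE.
rewrite /lyapunov !bilDm !bil_congr !bilMl !bilMr !mulmxDl -!mulmxA.
rewrite !(bilDl, bilDr) (bil_sym (D *m (L *m x)) (C *m y) Xs).
rewrite (bil_sym (B *m (L *m x)) y Xs).
lra.
Qed.

(** After the bound on [R], the terms in [u] are at least [psi] times
    [(1 - alpha) |D u|^2 + 2 w^T u], where [w = (B + C^T D)^T x]. The minimum of this expression
    over [u] is [- (1 - alpha)^-1 w^T (D^T D)^-1 w], the correction inside [lambda_alpha]. *)
Lemma subsolution_hamiltonian A B C D Q R alpha psi x u : (0 < d)%N ->
  0 < alpha -> alpha < 1 -> 0 <= psi -> D \in unitmx -> Q^T = Q ->
  loewner_le (- (alpha * psi *: (D^T *m D))) R ->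
  (min_eigenvalue (A^T + A + C^T *m C - (1 - alpha)^-1 *:
     ((B + C^T *m D) *m invmx (D^T *m D) *m (B^T + D^T *m C))) * psi
   + min_eigenvalue Q) * bil 1%:M x x
  <= hamiltonian A B C D Q R psi%:M x u.
Proof.
move=> d0 a0 a1 psi0 Du Qs Rge; set Lam := (X in min_eigenvalue X * psi).
pose E := D^T *m D.
have Es : E^T = E by rewrite /E trmx_mul trmxK.
have Eu : E \in unitmx by rewrite unitmx_mul unitmx_tr Du.
have crossT : (B^T + D^T *m C) = (B + C^T *m D)^T.
  by rewrite linearD /= trmx_mul trmxK.
have Lams : Lam^T = Lam.
  rewrite /Lam crossT -/E; set S := B + C^T *m D.
  have : (S *m invmx E *m S^T)^T = S *m invmx E *m S^T.
    by rewrite !trmx_mul !trmxK trmx_inv Es mulmxA.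
  set N := S *m invmx E *m S^T => NT.
  rewrite linearB linearZ /= NT !linearD /= !trmx_mul !trmxK.
  by rewrite [A + _]addrC.
have LamE := min_eigenvalue_le x d0 Lams.
have QE := min_eigenvalue_le x d0 Qs.
have RE := psd_ge0 u Rge.
rewrite opprK bilDm bilZm bilMl in RE.
have beta0 : 0 < 1 - alpha by rewrite subr_gt0.
pose w := (B + C^T *m D)^T *m x.
(* The square is completed at [(1 - alpha) u], so that one division by [1 - alpha] gives both the
   weight on [|D u|^2] and the inverse factor. *)
have SQ := completing_square ((1 - alpha) *: u) w Es Eu.
have EE y z : bil E y z = bil 1%:M (D *m y) (D *m z).
  by rewrite bilMl bil1r.
have E1 : bil 1%:M w u = bil 1%:M x (B *m u) + bil 1%:M (C *m x) (D *m u).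
  by rewrite bil1_sym -[LHS]bil1r bil_tr bilDm bilMl [bil B _ _]bil1r [bil D _ _]bil1r.
have E2 : bil ((B + C^T *m D) *m invmx E *m (B^T + D^T *m C)) x x = bil (invmx E) w w.
  by rewrite crossT -{1}[B + _]trmxK bil_congr.
have E4 : bil Lam x x = 2 * bil 1%:M x (A *m x) + bil 1%:M (C *m x) (C *m x)
    - (1 - alpha)^-1 * bil (invmx E) w w.
  rewrite /Lam bilBm bilZm E2 !bilDm bil_tr bilMl [bil C _ _]bil1r [bil A _ _]bil1r.
  by ring.
have E5 : hamiltonian A B C D Q R psi%:M x u =
    psi * (2 * bil 1%:M x (A *m x) + 2 * bil 1%:M x (B *m u) + bil 1%:M (C *m x) (C *m x)
    + 2 * bil 1%:M (C *m x) (D *m u) + bil 1%:M (D *m u) (D *m u)) + bil Q x x + bil R u u.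
  rewrite /hamiltonian !(bil_scalar psi) !(bilDl, bilDr) (bil1_sym (D *m u) (C *m x)); ring.
have SQ0 : 0 <= bil E ((1 - alpha) *: u + invmx E *m w) ((1 - alpha) *: u + invmx E *m w).
  by rewrite EE bil1_ge0.
have {SQ}SQ : - ((1 - alpha)^-1 * bil (invmx E) w w) <=
    (1 - alpha) * bil 1%:M (D *m u) (D *m u) + 2 * bil 1%:M w u.
  rewrite -(ler_pM2l beta0) mulrN mulrA divff ?gt_eqF // mul1r.
  move: SQ; rewrite bilZl !bilZr EE; lra.
apply: (@le_trans _ _ (psi * bil Lam x x + bil Q x x)).
  have := ler_wpM2l psi0 LamE; lra.
rewrite E4 E5.
have := ler_wpM2l psi0 SQ; rewrite E1; move: RE; rewrite [bil D _ _]bil1r; lra.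
Qed.

End RiccatiAlgebra.

(** * Absolutely continuous functions *)

Section AbsCont.
Context {K : realType}.
Implicit Types (T a b c : K) (f g : K -> K).
Local Notation mu := (@lebesgue_measure K).

(** Only points on opposite sides of [t] are compared, each with [f t], because the derivative is
    known at [t] alone. This suffices to carry a bound across a supremum. *)
Lemma derive_lt0_local f (t : K) : derivable f t 1 -> 'D_1 f t < 0 ->
  exists2 r, 0 < r & forall x y, t - r < x -> x <= t -> t <= y -> y < t + r ->
    f y <= f x.
Proof.
move=> df Df0.
have : \forall h \near 0^', h^-1 *: (f (h *: 1 + t) - f t) < 0.
  have cf : h^-1 *: (f (h *: 1 + t) - f t) @[h --> 0^'] --> 'D_1 f t := df.
  exact: (cvgr_lt _ cf _ Df0).
move=> [r /= r0 rP]; exists r => // x y trx xt ty ytr.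
have lo : f t <= f x.
  have [->//|xnt] := eqVneq x t.
  have xt0 : x - t < 0 by rewrite subr_lt0 lt_neqAle xnt.
  have := rP (x - t); rewrite /ball_ /= sub0r normrN => /(_ _ _).
  rewrite /GRing.scale /= mulr1 subrK ltr0_norm // nmulr_rlt0 ?invr_lt0 //.
  rewrite subr_gt0 => H; apply/ltW/H; [lra|by rewrite lt_eqF].
apply: le_trans lo.
have [->//|ynt] := eqVneq y t.
have yt0 : 0 < y - t by rewrite subr_gt0 lt_neqAle eq_sym ynt.
have := rP (y - t); rewrite /ball_ /= sub0r normrN => /(_ _ _).
rewrite /GRing.scale /= mulr1 subrK gtr0_norm // pmulr_rlt0 ?invr_gt0 //.
by rewrite subr_lt0 => H; apply/ltW/H; [lra|rewrite gt_eqF].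
Qed.

(** Outer regularity of Lebesgue measure. The points [a] and [b] are added to the null set, so that
    a point of [[a, b]] outside [U] lies strictly between them. *)
Lemma ae_on_open T a b (E : K -> Prop) (r : K) : 0 < r ->
  ae_on T E -> exists U : set K, [/\ open U, U a, U b, (mu U < r%:E)%E &
    forall t, t \in `[0, T] -> ~ U t -> E t].
Proof.
move=> r0 [N [mN N0 sN]].
have mN' : measurable (N `|` ([set a] `|` [set b])).
  by apply: measurableU => //; apply: measurableU.
have N'0 : mu (N `|` ([set a] `|` [set b])) = 0.
  apply: null_set_setU => //; first exact: measurableU.
  by apply: null_set_setU => //; exact: lebesgue_measure_set1.
have N'y : (mu (N `|` ([set a] `|` [set b])) < +oo)%E by rewrite N'0.
have [U [oU NU Ur]] := lebesgue_regularity_outer mN' N'y r0.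
exists U; split => //.
- by apply: NU; right; left.
- by apply: NU; right; right.
- have mU : measurable U by apply: measurable_realfun.open_measurable.
  apply: le_lt_trans Ur.
  rewrite [leLHS](_ : _ = mu ((U `\` (N `|` ([set a] `|` [set b]))) `|`
     (N `|` ([set a] `|` [set b])))); last by rewrite setUC setDUK.
  have mD := measurableD mU mN'.
  have N'le : (mu (N `|` ([set a] `|` [set b])) <= 0)%E by rewrite N'0.
  apply: (le_trans (measureU2 mu mD mN')).
  exact: geeDl.
- move=> t tT nUt; apply: contrapT => nE; apply/nUt/NU; left.
  by apply: sN => /= /(_ tT).
Qed.

(* A Cousin-type argument: the exceptional null set lies in an open set [U] of
   small measure. [S] is the set of points [x] up to which the increase of [f]
   is controlled by its variation over finitely many disjoint intervals of [U];
   [S] can be extended across its supremum, either inside [U] or by the negative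
   derivative, and absolute continuity makes the variation over [U] small. *)
Lemma absolutely_continuous_nonincreasing T f a b :
  abs_continuous T f -> 0 <= a -> a <= b -> b <= T ->
  ae_on T (fun t => a < t < b -> derivable f t 1 /\ 'D_1 f t < 0) ->
  f b <= f a.
Proof.
move=> ACf a0 ab bT aeD; apply/ler_addgt0Pl => e e0.
have [r r0 rP] := ACf _ e0.
have [U [oU Ua Ub Ur UP]] := ae_on_open a b r0 aeD.
pose chain x n (p q : nat -> K) :=
  [/\ forall i, (i < n)%N -> [/\ a <= p i, p i <= q i, q i <= x &
        `]p i, q i[%classic `<=` U],
      forall i j, (i < j < n)%N -> q i <= p j &
      f x - f a <= \sum_(i < n) `|f (q i) - f (p i)|].
pose S := [set x | a <= x <= b /\ exists n p q, chain x n p q].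
have Sa : S a.
  split; first by rewrite lexx.
  exists 0%N, (fun=> a), (fun=> a); split => //.
  by rewrite subrr big_ord0.
have hS : has_sup S by split; [exists a|exists b => x [/andP[]]].
have ubS := sup_upper_bound hS.
set s := sup S.
have as_ : a <= s by exact: ubS.
have sb : s <= b by apply: ge_sup => //; [exists a|move=> x [/andP[]]].
have step : exists2 d, 0 < d & forall x y, s - d < x -> x <= s -> s <= y ->
    y < s + d -> y <= b -> S x -> S y.
  have [Us|nUs] := pselect (U s).
    have /nbhs_ballP[d /= d0 dU] : nbhs s U by apply: open_nbhs_nbhs; split.
    exists d => // x y dx xs sy yd yb [/andP[ax xb] [n [p [q [C1 C2 C3]]]]].
    split; first by rewrite (le_trans ax) ?(le_trans xs).
    exists n.+1, (fun i => if (i < n)%N then p i else x),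
      (fun i => if (i < n)%N then q i else y).
    split.
    - move=> i _; case: ifPn => [/C1[? ? ? ?]|_].
        by split => //; rewrite (le_trans _ sy) ?(le_trans _ xs).
      split => //; first by rewrite (le_trans xs).
      move=> z /=; rewrite in_itv /= => /andP[xz zy]; apply: dU.
      by rewrite /ball /= ltr_norml; apply/andP; split; lra.
    - move=> i j /andP[ij]; rewrite ltnS leq_eqVlt => /predU1P[jn|jn].
        subst j; rewrite ltnn ij; by case: (C1 i ij).
      by rewrite jn (ltn_trans ij jn) C2 // ij.
    - rewrite big_ord_recr /= ltnn.
      under eq_bigr do rewrite ltn_ord.
      have := ler_norm (f y - f x); lra.
  have sab : a < s < b.
    rewrite !lt_neqAle as_ sb !andbT; apply/andP; split; apply/eqP => E.
      by apply: nUs; rewrite -E.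
    by apply: nUs; rewrite E.
  have s0T : s \in `[0, T] by rewrite in_itv /= (le_trans a0) // (le_trans sb).
  have [df Df] := UP s s0T nUs sab.
  have [d d0 dP] := derive_lt0_local df Df.
  exists d => // x y dx xs sy yd yb [/andP[ax xb] [n [p [q [C1 C2 C3]]]]].
  split; first by rewrite (le_trans ax) ?(le_trans xs).
  exists n, p, q; split => //.
    move=> i /C1[? ? ? ?]; split => //.
    by rewrite (le_trans _ sy) ?(le_trans _ xs).
  have := dP x y dx xs sy yd; lra.
have [d d0 dP] := step.
have [x Sx sdx] := sup_adherent d0 hS.
have xs : x <= s by exact: ubS.
have sb' : s = b.
  apply/eqP; rewrite eq_le sb /= leNgt; apply/negP => ltsb.
  pose y := Num.min b (s + d / 2).
  have sy : s < y by rewrite lt_min ltsb /=; lra.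
  have : S y.
    apply: (dP x y) => //; first exact: ltW.
      by rewrite gt_min; apply/orP; right; lra.
    by rewrite ge_min lexx.
  by move=> /ubS; rewrite leNgt sy.
(* [sup S = b] is not yet [S b]; one more use of [step], with [y = b], attains the supremum. *)
have [_ [n [p [q [C1 C2 C3]]]]] : S b.
  by apply: (dP x b) => //; rewrite sb' ltrDl.
rewrite -lerBlDr (le_trans C3) // ltW //.
have tI : trivIset [set: 'I_n] (fun i : 'I_n => `]p i, q i[%classic).
  have H (i j : 'I_n) z : (i < j)%N -> `]p i, q i[%classic z ->
      `]p j, q j[%classic z -> False.
    move=> ij; rewrite /= !in_itv /= => /andP[_ zq] /andP[pz _].
    have := C2 i j; rewrite ij ltn_ord => /(_ isT).
    by rewrite leNgt (lt_trans pz zq).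
  apply/trivIsetP => i j _ _ ij; rewrite -subset0 => z [zi zj].
  case: (ltngtP i j) => [lij|lji|/val_inj E].
  - exact: H lij zi zj.
  - exact: H lji zj zi.
  - by rewrite E eqxx in ij.
apply: (rP n (fun i => p i) (fun i => q i)) => //.
  move=> i; have [? ? ? _] := C1 i (ltn_ord i).
  by rewrite (le_trans a0) // (le_trans _ bT).
rewrite -lte_fin (le_lt_trans _ Ur) //.
have mI (i : 'I_n) : measurable (`]p i, q i[%classic : set K) by [].
have -> : (\sum_(i < n) (q i - p i))%:E =
    mu (\big[setU/set0]_(i < n) `]p i, q i[%classic).
  rewrite measure_semi_additive_ord //=; last by apply: bigsetU_measurable.
  rewrite -sumEFin; apply: eq_bigr => i _.
  rewrite lebesgue_measure_itv /= lte_fin.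
  case: ltP => // qp; have [_ pq _ _] := C1 i (ltn_ord i).
  by rewrite (@le_anti _ _ (q i) (p i)) ?subrr // qp pq.
apply: le_measure; rewrite ?inE //.
- by apply: bigsetU_measurable.
- exact: measurable_realfun.open_measurable.
- apply: (big_ind (fun A => A `<=` U)) => [z []|A B AU BU z [/AU|/BU]|i _] //.
  by case: (C1 i (ltn_ord i)).
Qed.

End AbsCont.

(** * Derivatives almost everywhere and comparison of increments *)

Section AbsCont2.
Context {K : realType}.
Implicit Types (T a b c : K) (f g : K -> K).
Local Notation mu := (@lebesgue_measure K).

Lemma ae_on_and T (E1 E2 : K -> Prop) :
  ae_on T E1 -> ae_on T E2 -> ae_on T (fun t => E1 t /\ E2 t).
Proof.
apply: (@filterS2 _ _ (ae_filter_ringOfSetsType mu)) => t h1 h2 tT.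
by split; [exact: h1|exact: h2].
Qed.

Lemma ae_on_imp T (E1 E2 : K -> Prop) :
  (forall t, t \in `[0, T] -> E1 t -> E2 t) -> ae_on T E1 -> ae_on T E2.
Proof.
move=> E12; apply: (@filterS _ _ (ae_filter_ringOfSetsType mu)) => t h1 tT.
exact/E12/h1.
Qed.

Lemma ae_onT T (E : K -> Prop) : (forall t, t \in `[0, T] -> E t) -> ae_on T E.
Proof. by move=> E1; rewrite /ae_on; apply: aeW => t tT; exact: E1. Qed.

Lemma ae_on_all T (I : finType) (E : I -> K -> Prop) :
  (forall i, ae_on T (E i)) -> ae_on T (fun t => forall i, E i t).
Proof.
move=> H; have : \forall t \near almost_everywhere mu, forall i, t \in `[0, T] -> E i t.
  by apply: (@filter_forall _ _ _ _ (ae_filter_ringOfSetsType mu)) => i; exact: H.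
by apply: (@filterS _ _ (ae_filter_ringOfSetsType mu)) => t h tT i; exact: h.
Qed.

Definition ac_deriv T f g :=
  abs_continuous T f /\ ae_on T (fun t => is_derive t 1 f (g t)).

Lemma lipschitz_abs_continuous (V : normedModType K) T (f : K -> V) c :
  (forall s t, 0 <= s -> s <= t -> t <= T -> `|f t - f s| <= c * (t - s)) ->
  abs_continuous T f.
Proof.
move=> fc e e0; exists (e / (`|c| + 1)).
  by rewrite divr_gt0 // ltr_wpDl.
move=> n a b ab _; rewrite ltr_pdivlMr ?ltr_wpDl // => H.
apply: le_lt_trans H.
rewrite mulr_suml; apply: ler_sum => i _.
have [a0 [aibi bT]] := ab i.
rewrite (le_trans (fc _ _ a0 aibi bT)) // mulrC ler_wpM2l ?subr_ge0 //.
by rewrite (le_trans (ler_norm c)) // lerDl.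
Qed.

Lemma ac_derivD T f f' g g' : ac_deriv T f f' -> ac_deriv T g g' ->
  ac_deriv T (fun t => f t + g t) (fun t => f' t + g' t).
Proof.
move=> [fA fD] [gA gD]; split; last first.
  apply: ae_on_imp (ae_on_and fD gD) => t _ [f1 g1].
  exact: is_deriveD.
move=> e e0; have e20 : 0 < e / 2 by lra.
have [r r0 rP] := fA _ e20; have [s s0 sP] := gA _ e20.
exists (Num.min r s); first by rewrite lt_min r0 s0.
move=> n a b ab tI; rewrite lt_min => /andP[H1 H2].
have /= := rP n a b ab tI H1; have /= := sP n a b ab tI H2 => S1 S2.
rewrite (splitr e); apply: le_lt_trans (ltrD S2 S1).
rewrite -big_split /=; apply: ler_sum => i _.
by rewrite opprD addrACA ler_normD.
Qed.

Lemma ac_derivZ T f f' c : ac_deriv T f f' ->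
  ac_deriv T (fun t => c * f t) (fun t => c * f' t).
Proof.
move=> [fA fD]; split; last first.
  by apply: ae_on_imp fD => t _ f1; exact: is_deriveZ.
move=> e e0; have [|r r0 rP] := fA (e / (`|c| + 1)).
  by rewrite divr_gt0 // ltr_wpDl.
exists r => // n a b ab tI /(rP n a b ab tI).
rewrite ltr_pdivlMr ?ltr_wpDl // => H.
apply: le_lt_trans H.
rewrite mulr_suml; apply: ler_sum => i _.
by rewrite -mulrBr normrM mulrC ler_wpM2l // lerDl.
Qed.

Lemma ac_derivB T f f' g g' : ac_deriv T f f' -> ac_deriv T g g' ->
  ac_deriv T (fun t => f t - g t) (fun t => f' t - g' t).
Proof.
move=> fd /(ac_derivZ (-1)) /(ac_derivD fd).
rewrite /ac_deriv; under eq_fun do rewrite mulN1r.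
by under [X in ae_on _ (fun t => is_derive t _ _ (X t))]eq_fun do rewrite mulN1r.
Qed.

Lemma ac_deriv_cst T c : ac_deriv T (fun=> c) (fun=> 0).
Proof.
split; last by apply: ae_onT => t _; exact: is_derive_cst.
by apply: (@lipschitz_abs_continuous _ _ _ 0) => s t _ _ _; rewrite subrr normr0 mul0r.
Qed.

Lemma ac_deriv_sum T (I : Type) (r : seq I) (f f' : I -> K -> K) :
  (forall i, ac_deriv T (f i) (f' i)) ->
  ac_deriv T (fun t => \sum_(i <- r) f i t) (fun t => \sum_(i <- r) f' i t).
Proof.
move=> H; elim: r => [|i r IH].
  under eq_fun do rewrite big_nil; under [X in ac_deriv _ _ X]eq_fun do rewrite big_nil.
  exact: ac_deriv_cst.
under eq_fun do rewrite big_cons; under [X in ac_deriv _ _ X]eq_fun do rewrite big_cons.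
exact: ac_derivD.
Qed.

Lemma ac_deriv_id T : ac_deriv T id (fun=> 1).
Proof.
split; last by apply: ae_onT => t _; exact: is_derive_id.
apply: (@lipschitz_abs_continuous _ _ _ 1) => s t _ st _.
by rewrite mul1r ger0_norm // subr_ge0.
Qed.

Lemma ac_deriv_le T f f' a b c : ac_deriv T f f' ->
  0 <= a -> a <= b -> b <= T ->
  ae_on T (fun t => a < t < b -> f' t <= c) -> f b - f a <= c * (b - a).
Proof.
move=> fd a0 ab bT f'c; apply/ler_addgt0Pl => e e0.
(* Monotonicity asks for a strictly negative derivative, so the slope is raised by [k], at a cost
   [k (b - a) <= e]; the [+ 1] covers [a = b]. *)
pose k := e / (b - a + 1).
have ba : 0 < b - a + 1 by lra.
have k0 : 0 < k by rewrite divr_gt0.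
have [gA gD] := ac_derivB fd (ac_derivZ (c + k) (ac_deriv_id T)).
have mono := absolutely_continuous_nonincreasing gA a0 ab bT.
have {}mono : f b - (c + k) * b <= f a - (c + k) * a.
  apply: mono; apply: ae_on_imp (ae_on_and gD f'c) => t _ [g1 f'1] tab; split => //.
  by rewrite derive_val mulr1; have := f'1 tab; lra.
have : k * (b - a) <= e.
  by rewrite /k mulrAC ler_pdivrMr // ler_wpM2l ?ltW //; lra.
lra.
Qed.

Lemma ac_deriv_cmp T f f' g g' a b : ac_deriv T f f' -> ac_deriv T g g' ->
  0 <= a -> a <= b -> b <= T ->
  ae_on T (fun t => a < t < b -> f' t <= g' t) -> f b - f a <= g b - g a.
Proof.
move=> fd gd a0 ab bT fg.
have := ac_deriv_le (c := 0) (ac_derivB fd gd) a0 ab bT.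
suff /[swap] /[apply] : ae_on T (fun t : K => a < t < b -> f' t - g' t <= 0).
  by rewrite mul0r; lra.
by apply: ae_on_imp fg => t _ H /H; rewrite subr_le0.
Qed.

Lemma ac_deriv_expR T k :
  ac_deriv T (fun t => expR (k * (T - t))) (fun t => - k * expR (k * (T - t))).
Proof.
have D (t : K) : is_derive t 1 (fun t => expR (k * (T - t))) (- k * expR (k * (T - t))).
  have := @is_derive1_comp _ expR (fun t => k * (T - t)) t _ (- k) (is_derive_expR _).
  rewrite mulrC; apply.
  have -> : - k = k *: (0 - 1) by rewrite sub0r scalerN /GRing.scale /= mulr1.
  by apply: is_deriveZ.
split; last exact: ae_onT.
apply: (@lipschitz_abs_continuous _ _ _ (`|k| * expR (`|k| * T))) => s t s0 st tT.
have [|x] := MVT_segment st (fun x _ => D x).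
  apply: derivable_within_continuous => x _; exact: ex_derive.
rewrite in_itv /= => /andP[sx xt] ->.
rewrite !normrM normrN (ger0_norm (expR_ge0 _)) ger0_norm ?subr_ge0 //.
rewrite ler_wpM2r ?subr_ge0 // ler_wpM2l // ler_expR.
apply: (@le_trans _ _ (`|k| * (T - x))).
  by rewrite ler_wpM2r ?ler_norm //; lra.
by rewrite ler_wpM2l //; lra.
Qed.

Lemma abs_continuous_within (V : normedModType K) T (f : K -> V) :
  abs_continuous T f -> forall t e, t \in `[0, T] -> 0 < e ->
  exists2 r, 0 < r & forall s, s \in `[0, T] -> `|s - t| < r -> `|f s - f t| < e.
Proof.
move=> fA t e tT e0; have [r r0 rP] := fA _ e0; exists r => // s sT str.
wlog st : s t tT sT str / s <= t.
  move=> H; have [st|/ltW ts] := leP s t; first exact: H.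
  by rewrite distrC H // distrC.
have := rP 1%N (fun=> s) (fun=> t); rewrite !big_ord1 distrC; apply.
- by move=> _; move: tT sT; rewrite !in_itv /= => /andP[_ ->] /andP[-> _].
- by apply/trivIsetP => i j; rewrite !ord1.
- by rewrite distrC ger0_norm ?subr_ge0 // in str.
Qed.

End AbsCont2.

(** * Primitives of bounded measurable functions *)

Section Primitive.
Context {K : realType}.
Implicit Types (T a b c : K) (f g h : K -> K).
Local Notation mu := (@lebesgue_measure K).

(** Extension by [0] makes a bounded measurable [h] locally integrable on the whole line, as the
    fundamental theorem of calculus asks. *)
Definition primitive T h t : K :=
  \int[mu]_(s in `[0, t]) ((h \_ `[0, T]) s).

Definition bounded_measurable T h c :=
  measurable_fun `[0, T] h /\ forall t, t \in `[0, T] -> `|h t| <= c.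

Lemma bounded_measurable_patch T h c : 0 <= T -> bounded_measurable T h c ->
  measurable_fun setT (h \_ `[0, T]) /\ forall t, `|(h \_ `[0, T]) t| <= c.
Proof.
move=> T0 [hm hc]; split; first exact/(measurable_restrictT _ _).1.
have c0 : 0 <= c by rewrite (le_trans _ (hc 0 _)) // in_itv /= lexx.
by move=> t; rewrite patchE; case: ifPn => [/set_mem/hc//|_]; rewrite normr0.
Qed.

Lemma lebesgue_measure_segment_lty a b : (mu `[a, b] < +oo)%E.
Proof. by rewrite lebesgue_measure_itv /=; case: ifP => _; rewrite -?EFinB ltry. Qed.

Lemma bounded_measurable_integrable g c a b : measurable_fun setT g ->
  (forall t, `|g t| <= c) -> mu.-integrable `[a, b] (EFin \o g).
Proof.
move=> gm gc; apply: measurable_bounded_integrable => //.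
- exact: lebesgue_measure_segment_lty.
- exact: measurable_funS gm.
- exists c; split; first exact: num_real.
  by move=> x cx t _ /=; rewrite (le_trans (gc t)) // ltW.
Qed.

Lemma primitive_lipschitz T h c s t : 0 <= T -> bounded_measurable T h c ->
  0 <= s -> s <= t -> `|primitive T h t - primitive T h s| <= c * (t - s).
Proof.
move=> T0 /(bounded_measurable_patch T0)[gm gc] s0 st.
have ig := bounded_measurable_integrable 0 t gm gc.
rewrite /primitive Rintegral_itvB // ?bnd_simp //.
have ig' : mu.-integrable `]s, t] (EFin \o (h \_ `[0, T])).
  by apply: integrableS ig => // x /=; rewrite !in_itv /= => /andP[/ltW sx ->];
    rewrite (le_trans s0 sx).
rewrite (le_trans (le_normr_Rintegral _ ig')) //.
have -> : c * (t - s) = \int[mu]_(x in `]s, t]) c.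
  have mst : mu `]s, t]%classic = (t - s)%:E.
    rewrite lebesgue_measure_itv /= lte_fin.
    case: ltP => // ts; rewrite (@le_anti _ _ s t) ?subrr //.
    by rewrite st.
  by rewrite Rintegral_cst //; congr (_ * _); exact: (esym (congr1 fine mst)).
apply: le_Rintegral => //.
  exact: integrable_norm ig'.
have ic := bounded_measurable_integrable s t (measurable_cst c) (fun=> lexx `|c|).
apply: integrableS ic => // x /=.
by rewrite !in_itv /= => /andP[/ltW -> ->].
Qed.

Lemma ac_deriv_primitive T h c : 0 <= T -> bounded_measurable T h c ->
  ac_deriv T (primitive T h) h.
Proof.
move=> T0 hb; split.
  apply: (@lipschitz_abs_continuous _ _ _ _ c) => s t s0 st _.
  exact: primitive_lipschitz.
have [gm gc] := bounded_measurable_patch T0 hb.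
have ig y := bounded_measurable_integrable 0 y gm gc.
have lg : locally_integrable setT (h \_ `[0, T]).
  apply: integrable_locally => //.
  have := ig T; apply: eq_integrable => // x /set_mem xT /=.
  by rewrite patchE mem_set.
have F1 := FTC1 (a := BLeft 0) ig lg.
(* The fundamental theorem speaks of [t > 0]; the origin is discarded as one more null set. *)
have F0 : {ae mu, forall t : K, t != 0}.
  exists [set 0]; split => //; first exact: lebesgue_measure_set1.
  by move=> t /= /negP; rewrite negbK => /eqP.
suff F2 (t : K) : t != 0 -> ((0%:E < t%:E)%E ->
    derivable (primitive T h) t 1 /\ derive1 (primitive T h) t = (h \_ `[0, T]) t) ->
    t \in `[0, T] -> is_derive t 1 (primitive T h) (h t).
  by move: F0 F1; apply: (@filterS2 _ _ (ae_filter_ringOfSetsType mu)) => t;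
    exact: F2.
move=> tn0 H tT.
have t0 : (0%:E < t%:E)%E.
  by move: tT; rewrite in_itv /= lte_fin lt_neqAle eq_sym tn0 => /andP[].
have [D1 D2] := H t0.
by apply: DeriveDef => //; rewrite -derive1E D2 patchE mem_set.
Qed.

Lemma primitive_cvg T (h : nat -> K -> K) (g : K -> K) c t : 0 <= T ->
  (forall n, bounded_measurable T (h n) c) ->
  (forall s, s \in `[0, T] -> h n s @[n --> \oo] --> g s) ->
  bounded_measurable T g c /\
  (primitive T (h n) t @[n --> \oo] --> primitive T g t).
Proof.
move=> T0 hb hg.
have gb : bounded_measurable T g c.
  split.
    apply: (@measurable_fun_cvg _ _ _ _ h) => //; first by move=> n; case: (hb n).
  move=> s sT; have hgs := hg s sT.
  apply: (cvgr_to_le (cvg_norm hgs)).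
  by near=> n; have [_ ->] := hb n.
split => //; rewrite /primitive /Rintegral.
have [gm gc] := bounded_measurable_patch T0 gb.
have hp n := bounded_measurable_patch T0 (hb n).
have ig := bounded_measurable_integrable 0 t gm gc.
apply: fine_cvg; rewrite fineK; last exact: integrable_fin_num.
have [] // := @dominated_convergence _ _ _ mu `[0, t]%classic _
   (fun n x => ((h n \_ `[0, T]) x)%:E) (fun x => ((g \_ `[0, T]) x)%:E) (cst c%:E).
- by move=> n; apply/measurable_EFinP; apply: measurable_funS (hp n).1.
- by apply/measurable_EFinP; apply: measurable_funS gm.
- apply: aeW => x _; apply: cvg_EFin; first exact: nearW.
  apply: (@cvg_trans _ ((h n \_ `[0, T]) x @[n --> \oo])) => //.
  case: (boolP (x \in `[0, T]%classic)) => xT.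
    rewrite (_ : (fun n => (h n \_ `[0, T]) x) = h ^~ x); last first.
      by apply/funext => n; rewrite patchE xT.
    by rewrite patchE xT; apply: hg; exact: set_mem xT.
  rewrite (_ : (fun n => (h n \_ `[0, T]) x) = fun=> 0); last first.
    by apply/funext => n; rewrite patchE (negPf xT).
  by rewrite patchE (negPf xT); exact: cvg_cst.
- exact: (bounded_measurable_integrable 0 t (measurable_cst c) (fun=> lexx `|c|)).
- by apply: aeW => x n _ /=; rewrite lee_fin (hp n).2.
Unshelve. all: end_near.
Qed.

End Primitive.

(** * Positivity of linear Lyapunov equations *)

Section Positivity.
Context {K : realType} {d : nat}.
Implicit Types (T a b c e r s t : K) (M N U V : K -> 'M[K]_d) (x y : 'cV[K]_d).

Definition mx_ac_deriv T M M' :=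
  forall i j, ac_deriv T (fun t => M t i j) (fun t => M' t i j).

Lemma mx_ac_deriv_bil T M M' x y : mx_ac_deriv T M M' ->
  ac_deriv T (fun t => bil (M t) x y) (fun t => bil (M' t) x y).
Proof.
move=> MM'; under eq_fun do rewrite bilE.
under [X in ac_deriv _ _ X]eq_fun do rewrite bilE.
apply: ac_deriv_sum => i; apply: ac_deriv_sum => j.
have := ac_derivZ (x i ord0 * y j ord0) (MM' i j).
under eq_fun do rewrite mulrAC.
by under [X in ac_deriv _ _ X]eq_fun do rewrite mulrAC.
Qed.

Lemma mx_ac_deriv_within T M M' t e : mx_ac_deriv T M M' -> t \in `[0, T] ->
  0 < e -> exists2 r, 0 < r & forall s, s \in `[0, T] -> `|s - t| < r ->
    forall i j, `|(M s - M t) i j| <= e.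
Proof.
move=> MM' tT e0.
have near_t ij : \forall s \near t, s \in `[0, T] ->
    `|(M s - M t) ij.1 ij.2| <= e.
  have [r r0 rP] := abs_continuous_within (MM' ij.1 ij.2).1 tT e0.
  apply/nbhs_ballP; exists r => // s; rewrite /ball /= distrC => st sT.
  by rewrite !mxE ltW // rP.
have /nbhs_ballP[r /= r0 rP] : nbhs t (fun s => forall ij : 'I_d * 'I_d,
    s \in `[0, T] -> `|(M s - M t) ij.1 ij.2| <= e).
  exact: filter_forall near_t.
exists r => // s sT st i j.
by apply: (rP s _ (i, j)) => //; rewrite /ball /= distrC.
Qed.

Lemma mulmx_norm_le (M N : 'M[K]_d) a b : (forall i j, `|M i j| <= a) ->
  (forall i j, `|N i j| <= b) -> forall i j, `|(M *m N) i j| <= d%:R * (a * b).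
Proof.
move=> Ma Nb i j; rewrite mxE (le_trans (ler_norm_sum _ _ _)) //.
apply: (@le_trans _ _ (\sum_(k < d) a * b)); last first.
  by rewrite sumr_const card_ord mulr_natl.
by apply: ler_sum => k _; rewrite normrM ler_pM.
Qed.

(** The entries of [V^T V] are at most [d c^2], and [bil_norm_le] contributes the further factor
    [2 d]. *)
Lemma bil1_mulmx_le (V : 'M[K]_d) c x : (forall i j, `|V i j| <= c) ->
  bil 1%:M (V *m x) (V *m x) <= d%:R * (c * c) * d%:R * 2 * bil 1%:M x x.
Proof.
move=> Vc; rewrite -bil1r -bilMl.
have VV := mulmx_norm_le (M := V^T) (fun i j => _ : `|V^T i j| <= c) Vc.
have {}VV i j : `|(V^T *m V) i j| <= d%:R * (c * c).
  by apply: VV => i' j'; rewrite mxE.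
have := bil_norm_le x x VV => /(le_trans (ler_norm _)) H.
by apply: (le_trans H); rewrite le_eqVlt; apply/orP; left; apply/eqP; ring.
Qed.

(* Let [t0] be least such that [M] is positive semidefinite on [t0, T]. If [M t0]
   is positive definite it stays so slightly before [t0]; otherwise [M t0 x = 0]
   for some [x != 0], and the term [- e |x|^2] makes [x^T M x] negative just after
   [t0]. *)
Lemma lyapunov_strict T M M' U V c e : 0 <= T -> 0 < e ->
  mx_ac_deriv T M M' -> (forall t, t \in `[0, T] -> (M t)^T = M t) ->
  posdefmx (M T) ->
  ae_on T (fun t => forall i j, `|U t i j| <= c) ->
  ae_on T (fun t => forall x, bil (M' t) x x <=
     - (2 * bil (M t) x (U t *m x) + bil (M t) (V t *m x) (V t *m x))
     - e * bil 1%:M x x) ->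
  forall t, t \in `[0, T] -> possemidefmx (M t).
Proof.
move=> T0 e0 MM' Msym MT Uc MV.
pose S := [set t | t \in `[0, T] /\ forall s, t <= s <= T -> possemidefmx (M s)].
have TS : S T.
  split; first by rewrite in_itv /= T0 lexx.
  by move=> s /le_anti <-; exact: posdef_psd.
have hS : has_inf S by split; [exists T|exists 0 => t []; rewrite in_itv /= => /andP[]].
have lbS := inf_lbound hS.2.
set t0 := inf S.
have t00 : 0 <= t0.
  by apply: lb_le_inf; [exists T|move=> t []; rewrite in_itv /= => /andP[]].
have t0T : t0 <= T by exact: lbS.
have t0I : t0 \in `[0, T] by rewrite in_itv /= t00.
have psd_gt s : t0 < s -> s <= T -> possemidefmx (M s).
  move=> ts sT; have st0 : 0 < s - t0 by rewrite subr_gt0.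
  have [t [_ H]] := inf_adherent st0 hS.
  by rewrite -/t0 addrC subrK => /ltW tls; apply: H; rewrite tls.
(* The infimum itself: a negative value of the form at [t0] would persist slightly to the right,
   where [M] is already positive semidefinite. If [t0 = T], the terminal condition applies. *)
have psd_t0 : possemidefmx (M t0).
  have [<-|t0nT] := eqVneq T t0; first exact: posdef_psd.
  have ltt0 : t0 < T by rewrite lt_neqAle eq_sym t0nT.
  split; first by apply/symmetricmxP; exact: Msym.
  move=> x; rewrite leNgt; apply/negP => Mx0.
  have mMx0 : 0 < - bil (M t0) x x by rewrite oppr_gt0.
  have [r r0 rP] := abs_continuous_within (mx_ac_deriv_bil x x MM').1 t0I mMx0.
  pose s := Num.min T (t0 + r / 2).
  have t0s : t0 < s by rewrite lt_min ltt0 /=; lra.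
  have sT : s <= T by rewrite ge_min lexx.
  have sr : s <= t0 + r / 2 by rewrite ge_min lexx orbT.
  have sI : s \in `[0, T] by rewrite in_itv /= sT (le_trans t00 (ltW t0s)).
  have s_r : `|s - t0| < r by rewrite ltr_norml; apply/andP; split; lra.
  have Ms := rP s sI s_r.
  have := psd_ge0 x (psd_gt s t0s sT).
  have := ler_norm (bil (M s) x x - bil (M t0) x x).
  rewrite -/(bil _ x x) in Mx0 *; lra.
have psd_ge s : t0 <= s -> s <= T -> possemidefmx (M s).
  by rewrite le_eqVlt => /predU1P[<-//|]; exact: psd_gt.
suff t0_0 : t0 = 0.
  by move=> t; rewrite in_itv /= => /andP[t_ge tT]; apply: psd_ge => //; rewrite t0_0.
apply/eqP/negPn/negP => t0n0.
have t0p : 0 < t0 by rewrite lt_neqAle eq_sym t0n0.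
have [Mp|nMp] := pselect (posdefmx (M t0)).
  have [a a0 aM] := posdef_coercive Mp.
  (* An entrywise error [h] moves the form by at most [2 d h |x|^2], which stays within
     [a |x|^2]. *)
  pose h := a / (d%:R * 2 + 1).
  have h0 : 0 < h by rewrite divr_gt0 // ltr_wpDl // mulr_ge0.
  have [r r0 rP] := mx_ac_deriv_within MM' t0I h0.
  pose s := Num.max 0 (t0 - r / 2).
  have s0 : 0 <= s by rewrite le_max lexx.
  have sr : t0 - r / 2 <= s by rewrite le_max lexx orbT.
  have st0 : s < t0 by rewrite gt_max t0p /=; lra.
  have : S s.
    split; first by rewrite in_itv /= s0 (le_trans (ltW st0)).
    move=> t /andP[st tT]; have [/psd_ge|tt0] := leP t0 t; first exact.
    have tI : t \in `[0, T] by rewrite in_itv /= (le_trans s0).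
    split; first by apply/symmetricmxP; exact: Msym.
    move=> x; rewrite -/(bil (M t) x x).
    have tr : `|t - t0| < r by rewrite ltr_norml; apply/andP; split; lra.
    have := bil_norm_le x x (rP t tI tr); rewrite ler_norml => /andP[+ _].
    rewrite bilBm => H; have := aM x.
    suff : h * d%:R * (bil 1%:M x x + bil 1%:M x x) <= a * bil 1%:M x x by lra.
    have -> : h * d%:R * (bil 1%:M x x + bil 1%:M x x) =
      h * (d%:R * 2) * bil 1%:M x x by ring.
    rewrite ler_wpM2r ?bil1_ge0 // /h mulrAC ler_pdivrMr ?ltr_wpDl ?mulr_ge0 //.
    by rewrite ler_wpM2l ?(ltW a0) // lerDl.
  by move=> /lbS; rewrite leNgt st0.
have [x x0 Mx0] : exists2 x, x != 0 & bil (M t0) x x = 0.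
  apply: contrapT => H; apply: nMp; split; first by case: psd_t0.
  move=> x x0; have := psd_ge0 x psd_t0; rewrite le_eqVlt => /predU1P[E|//].
  by exfalso; apply: H; exists x.
have ltt0 : t0 < T.
  rewrite lt_neqAle t0T andbT; apply/eqP => t0T'.
  by have := MT.2 x x0; rewrite -t0T' -/(bil _ x x) Mx0 ltxx.
have xx0 := bil1_gt0 x0.
pose k := d%:R * (c * c) * d%:R * 2.
have cc0 : 0 <= c * c by rewrite -expr2 sqr_ge0.
have k0 : 0 <= k by rewrite /k; do ![apply: mulr_ge0 => //].
(* Chosen so that [2 h d (1 + k) <= e / 2]: the cross term then consumes at most half of the margin
   [e |x|^2]. *)
pose q := d%:R * (1 + k) * 2 + 1.
have q0 : 0 < q by rewrite ltr_wpDl // !mulr_ge0 // addr_ge0.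
pose h := e / 2 / q.
have h0 : 0 < h by rewrite !divr_gt0.
have [r r0 rP] := mx_ac_deriv_within MM' t0I h0.
pose s := Num.min T (t0 + r / 2).
have t0s : t0 < s by rewrite lt_min ltt0 /=; lra.
have sT : s <= T by rewrite ge_min lexx.
have sr : s <= t0 + r / 2 by rewrite ge_min lexx orbT.
have := ac_deriv_le (c := - (e / 2 * bil 1%:M x x)) (mx_ac_deriv_bil x x MM')
  t00 (ltW t0s) sT.
rewrite Mx0 subr0 => H.
have := psd_ge0 x (psd_gt s t0s sT); rewrite leNgt => /negP; apply.
apply: le_lt_trans (H _) _; last first.
  by rewrite mulNr oppr_lt0 !mulr_gt0 ?subr_gt0 // invr_gt0.
apply: ae_on_imp (ae_on_and Uc MV) => t tI [Ut /(_ x) Mt] /andP[t0t ts].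
have tr : `|t - t0| < r by rewrite ltr_norml; apply/andP; split; lra.
have tT : t <= T by lra.
have V0 := psd_ge0 (V t *m x) (psd_gt t t0t tT).
(* As [M t0 x = 0], the cross term sees only the small difference [M t - M t0]. The term in [V] has
   the favourable sign, since [M t] is positive semidefinite to the right of [t0]. *)
have MU : bil (M t) x (U t *m x) = bil (M t - M t0) x (U t *m x).
  rewrite bilBm (bil_sym x (U t *m x) (psd_sym psd_t0)) [bil (M t0) _ _]bil1r.
  by rewrite (psd_ker psd_t0 Mx0) bil0r subr0.
have := bil_norm_le x (U t *m x) (rP t tI tr); rewrite -MU ler_norml => /andP[B _].
have Ux := bil1_mulmx_le x Ut; rewrite -/k in Ux.
have hd : 2 * (h * d%:R * (1 + k)) <= e / 2.
  have -> : 2 * (h * d%:R * (1 + k)) = e / 2 * (d%:R * (1 + k) * 2 / q).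
    by rewrite /h; field; rewrite gt_eqF.
  rewrite ler_piMr ?divr_ge0 ?(ltW e0) // ler_pdivrMr // mul1r /q; lra.
have hd' : 2 * (h * d%:R * (bil 1%:M x x + bil 1%:M (U t *m x) (U t *m x)))
    <= e / 2 * bil 1%:M x x.
  apply: (@le_trans _ _ (2 * (h * d%:R * (1 + k)) * bil 1%:M x x)).
    have -> : 2 * (h * d%:R * (1 + k)) * bil 1%:M x x =
      2 * (h * d%:R * (bil 1%:M x x + k * bil 1%:M x x)) by ring.
    apply: ler_wpM2l => //; apply: ler_wpM2l; first by rewrite mulr_ge0 // ltW.
    by rewrite lerD2l.
  by rewrite ler_wpM2r // bil1_ge0.
lra.
Qed.

Lemma lyapunov_positive T M M' U V c : 0 <= T ->
  mx_ac_deriv T M M' -> (forall t, t \in `[0, T] -> (M t)^T = M t) ->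
  possemidefmx (M T) ->
  ae_on T (fun t => forall i j, `|U t i j| <= c) ->
  ae_on T (fun t => forall i j, `|V t i j| <= c) ->
  ae_on T (fun t => forall x, bil (M' t) x x <=
     - (2 * bil (M t) x (U t *m x) + bil (M t) (V t *m x) (V t *m x))) ->
  forall t, t \in `[0, T] -> possemidefmx (M t).
Proof.
move=> T0 MM' Msym MT Uc Vc MV t tI.
split; first by apply/symmetricmxP; exact: Msym.
move=> x; rewrite -/(bil (M t) x x).
(* The first summand bounds the term in [U], the second the term in [V]; the last [1] is the surplus
   that gives strictness. *)
pose k := `|c| * d%:R * 4 + d%:R * (c * c) * d%:R * 2 + 1.
have cc0 : 0 <= c * c by rewrite -expr2 sqr_ge0.
have kk0 : 0 <= k.
  by rewrite /k; do ![apply: addr_ge0 => //|apply: mulr_ge0 => //].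
(* Adding [e w(t) I] makes the inequality strict, since [- w' = k w] dominates
   the Lyapunov operator. *)
pose w t := expR (k * (T - t)).
have w1 s : s \in `[0, T] -> 1 <= w s.
  rewrite in_itv /= => /andP[_ sT]; rewrite -expR0 ler_expR mulr_ge0 // subr_ge0 //.
suff H e : 0 < e -> 0 <= bil (M t) x x + e * (w t * bil 1%:M x x).
  have wt0 : 0 <= w t * bil 1%:M x x by rewrite mulr_ge0 ?expR_ge0 ?bil1_ge0.
  rewrite -oppr_le0; apply/ler_addgt0Pl => e e0; rewrite addr0.
  have p0 : 0 < w t * bil 1%:M x x + 1 by rewrite ltr_wpDl.
  have := H (e / (w t * bil 1%:M x x + 1)); rewrite divr_gt0 // => /(_ isT).
  suff : e / (w t * bil 1%:M x x + 1) * (w t * bil 1%:M x x) <= e by lra.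
  by rewrite mulrAC ler_pdivrMr // ler_wpM2l ?ltW //; lra.
move=> e0.
have [_ ] : possemidefmx (M t + (e * w t)%:M); last first.
  by move=> /(_ x); rewrite -/(bil _ x x) bilDm (bil_scalar (e * w t)) mulrA.
apply: (@lyapunov_strict T (fun t => M t + (e * w t)%:M)
  (fun t => M' t + (e * (- k * w t))%:M) U V c e) => //.
- move=> i j; under eq_fun do rewrite !mxE.
  under [X in ac_deriv _ _ X]eq_fun do rewrite !mxE.
  apply: ac_derivD; first exact: MM'.
  case: (i == j).
    exact: ac_derivZ (ac_deriv_expR _ _).
  exact: ac_deriv_cst.
- by move=> s sI; rewrite linearD /= tr_scalar_mx Msym.
- have TI : T \in `[0, T] by rewrite in_itv /= T0 lexx.
  apply: (@coercive_posdef _ _ _ e) => //.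
    by rewrite linearD /= tr_scalar_mx Msym.
  move=> y; rewrite bilDm (bil_scalar (e * w T)); have := psd_ge0 y MT.
  have : e * bil 1%:M y y <= e * w T * bil 1%:M y y.
    by rewrite ler_wpM2r ?bil1_ge0 // ler_peMr ?(ltW e0) // w1.
  lra.
- apply: ae_on_imp (ae_on_and Uc (ae_on_and Vc MV)) => s sI [Us [Vs H]] y.
  rewrite !bilDm (bil_scalar (_ * (_ * _))) !(bil_scalar (e * w s)) -bil1r; have := H y.
  have HV := bil1_mulmx_le y Vs.
  have Us' i j : `|U s i j| <= `|c| by rewrite (le_trans (Us i j)) ?ler_norm.
  have HU := le_trans (ler_norm _) (bil_norm_le y y Us').
  have y0 := bil1_ge0 y; have ws := w1 s sI.
  have HUV : 2 * bil (U s) y y + bil 1%:M (V s *m y) (V s *m y) <= (k - 1) * bil 1%:M y y.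
    rewrite /k; lra.
  have ew0 : 0 <= e * w s by rewrite mulr_ge0 ?expR_ge0 ?(ltW e0).
  have := ler_wpM2l ew0 HUV.
  have : e * bil 1%:M y y <= e * w s * bil 1%:M y y.
    by rewrite ler_wpM2r // ler_peMr // ?(ltW e0).
  lra.
Qed.

End Positivity.

(** * Algebras of scalar functions *)

Section FunAlgebra.
Context {K : realType} {U : Type}.
Implicit Types (S : (U -> K) -> Prop) (E : set U) (f g : U -> K).

(* Membership of the entries of a matrix expression in a class of scalar
   functions (measurable, continuous, bounded, convergent) only uses that the
   class is an algebra, up to equality on the domain [E]. *)
Record fun_algebra E S : Prop := FunAlgebra {
  fa_eq : forall f g, {in E, f =1 g} -> S f -> S g;
  fa_cst : forall c, S (fun=> c);
  fa_add : forall f g, S f -> S g -> S (fun u => f u + g u);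
  fa_mul : forall f g, S f -> S g -> S (fun u => f u * g u) }.

Definition mx_in m n S (M : U -> 'M[K]_(m, n)) :=
  forall i j, S (fun u => M u i j).

Context {E : set U} {S : (U -> K) -> Prop} (AS : fun_algebra E S).

Lemma fa_opp f : S f -> S (fun u => - f u).
Proof.
move=> Sf; apply: (fa_eq AS) (fa_mul AS (fa_cst AS (-1)) Sf) => u _.
by rewrite mulN1r.
Qed.

Lemma fa_sum (I : Type) (r : seq I) (F : I -> U -> K) :
  (forall i, S (F i)) -> S (fun u => \sum_(i <- r) F i u).
Proof.
move=> SF; elim: r => [|i r IH].
  by apply: (fa_eq AS) (fa_cst AS 0) => u _; rewrite big_nil.
by apply: (fa_eq AS) (fa_add AS (SF i) IH) => u _; rewrite big_cons.
Qed.

Lemma fa_prod (I : Type) (r : seq I) (F : I -> U -> K) :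
  (forall i, S (F i)) -> S (fun u => \prod_(i <- r) F i u).
Proof.
move=> SF; elim: r => [|i r IH].
  by apply: (fa_eq AS) (fa_cst AS 1) => u _; rewrite big_nil.
by apply: (fa_eq AS) (fa_mul AS (SF i) IH) => u _; rewrite big_cons.
Qed.

Lemma mx_in_eq m n (M N : U -> 'M[K]_(m, n)) : {in E, M =1 N} ->
  mx_in S M -> mx_in S N.
Proof. by move=> MN SM i j; apply: (fa_eq AS) (SM i j) => u /MN ->. Qed.

Lemma mx_in_cst m n (M : 'M[K]_(m, n)) : mx_in S (fun=> M).
Proof. by move=> i j; exact: (fa_cst AS). Qed.

Lemma mx_in_add m n (M N : U -> 'M[K]_(m, n)) :
  mx_in S M -> mx_in S N -> mx_in S (fun u => M u + N u).
Proof.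
move=> SM SN i j; apply: (fa_eq AS) (fa_add AS (SM i j) (SN i j)) => u _.
by rewrite mxE.
Qed.

Lemma mx_in_opp m n (M : U -> 'M[K]_(m, n)) : mx_in S M -> mx_in S (fun u => - M u).
Proof.
by move=> SM i j; apply: (fa_eq AS) (fa_opp (SM i j)) => u _; rewrite mxE.
Qed.

Lemma mx_in_scale m n f (M : U -> 'M[K]_(m, n)) :
  S f -> mx_in S M -> mx_in S (fun u => f u *: M u).
Proof.
move=> Sf SM i j; apply: (fa_eq AS) (fa_mul AS Sf (SM i j)) => u _.
by rewrite mxE.
Qed.

Lemma mx_in_tr m n (M : U -> 'M[K]_(m, n)) : mx_in S M -> mx_in S (fun u => (M u)^T).
Proof. by move=> SM i j; apply: (fa_eq AS) (SM j i) => u _; rewrite mxE. Qed.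

Lemma mx_in_mul m n p (M : U -> 'M[K]_(m, n)) (N : U -> 'M[K]_(n, p)) :
  mx_in S M -> mx_in S N -> mx_in S (fun u => M u *m N u).
Proof.
move=> SM SN i j; pose F k u := M u i k * N u k j.
apply: (fa_eq AS) (_ : S (fun u => \sum_k F k u)) => [u _|].
  by rewrite mxE.
by apply: fa_sum => k; apply: (fa_mul AS).
Qed.

Lemma fa_det n (M : U -> 'M[K]_n) : mx_in S M -> S (fun u => \det (M u)).
Proof.
move=> SM; apply: fa_sum => s; apply: (fa_mul AS); first exact: (fa_cst AS).
by apply: fa_prod => i; exact: SM.
Qed.

Lemma mx_in_adj n (M : U -> 'M[K]_n) : mx_in S M -> mx_in S (fun u => \adj (M u)).
Proof.
move=> SM i j; apply: (fa_eq AS) (_ : S (fun u => cofactor (M u) j i)) => [u _|].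
  by rewrite mxE.
apply: (fa_mul AS); first exact: (fa_cst AS).
apply: fa_det => k l; apply: (fa_eq AS) (SM (lift j k) (lift i l)) => u _.
by rewrite !mxE.
Qed.

(** Cramer's rule: determinant and adjugate are polynomial in the entries, so only the reciprocal of
    one scalar function has to be supplied by the class at hand. *)
Lemma mx_in_inv n (M : U -> 'M[K]_n) : (forall u, E u -> M u \in unitmx) ->
  mx_in S M -> S (fun u => (\det (M u))^-1) -> mx_in S (fun u => invmx (M u)).
Proof.
move=> Mu SM Sd.
apply: mx_in_eq (mx_in_scale Sd (mx_in_adj SM)) => u /set_mem/Mu uE.
by rewrite /invmx uE.
Qed.

End FunAlgebra.

(** * The four classes: bounded, measurable, continuous, convergent *)

Section FunAlgebraInstances.
Context {K : realType}.
Implicit Types (T c : K) (f g : K -> K).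

Definition bounded_on (U : Type) (E : set U) (f : U -> K) :=
  exists c, forall u, E u -> `|f u| <= c.

Lemma bounded_algebra (U : Type) (E : set U) : fun_algebra E (bounded_on E).
Proof.
split.
- by move=> f g fg [c fc]; exists c => u Eu; rewrite -fg ?fc //; exact: mem_set.
- by move=> c; exists `|c|.
- move=> f g [a fa] [b gb]; exists (a + b) => u Eu.
  by rewrite (le_trans (ler_normD _ _)) // lerD ?fa ?gb.
- move=> f g [a fa] [b gb]; exists (a * b) => u Eu.
  by rewrite normrM ler_pM ?fa ?gb.
Qed.

Lemma mx_bounded_uniform (U : Type) (E : set U) d (M : U -> 'M[K]_d) :
  mx_in (bounded_on E) M ->
  exists2 c, 0 <= c & forall u, E u -> forall i j, `|M u i j| <= c.
Proof.
move=> Mb; pose b i j := `|sval (cid (Mb i j))|.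
have b0 i j : 0 <= b i j by exact: normr_ge0.
exists (\sum_i \sum_j b i j).
  by rewrite sumr_ge0 // => i _; rewrite sumr_ge0.
move=> u Eu i j; apply: (@le_trans _ _ (b i j)).
  rewrite /b; case: cid => c /= Mc.
  exact: le_trans (Mc u Eu) (ler_norm c).
rewrite (bigD1 i) //= (bigD1 j) //= -addrA lerDl.
by rewrite addr_ge0 ?sumr_ge0 // => i' _; rewrite sumr_ge0.
Qed.

Definition measurable_on T f := measurable_fun `[0, T] f.

Lemma measurable_algebra T : fun_algebra `[0, T]%classic (measurable_on T).
Proof.
split.
- by move=> f g fg fm; exact: eq_measurable_fun fm.
- by move=> c; exact: measurable_cst.
- by move=> f g fm gm; exact: measurable_funD.
- by move=> f g fm gm; exact: measurable_funM.
Qed.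

Definition continuous_on T f := {within `[0, T], continuous f}.

Lemma continuous_algebra T : fun_algebra `[0, T]%classic (continuous_on T).
Proof.
split.
- by move=> f g fg fc; exact: subspace_eq_continuous fc.
- by move=> c t; exact: cvg_cst.
- by move=> f g fc gc t; apply: cvgD; [exact: fc|exact: gc].
- by move=> f g fc gc t; apply: cvgM; [exact: fc|exact: gc].
Qed.

Lemma continuous_on_measurable T f : continuous_on T f -> measurable_on T f.
Proof. by move=> fc; exact: subspace_continuous_measurable_fun. Qed.

Lemma continuous_on_bounded T f : 0 <= T -> continuous_on T f -> bounded_on `[0, T]%classic f.
Proof.
move=> T0 fc.
have [a aI fa] := EVT_max T0 fc; have [b bI fb] := EVT_min T0 fc.
exists (`|f a| + `|f b|) => t tI.
have := fa t tI; have := fb t tI.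
have := ler_norm (f a); have := ler_norm (- f b); rewrite normrN.
have := normr_ge0 (f a); have := normr_ge0 (f b).
by rewrite ler_norml => *; apply/andP; split; lra.
Qed.

Lemma continuous_on_inv T f : (forall t, t \in `[0, T] -> f t != 0) ->
  continuous_on T f -> continuous_on T (fun t => (f t)^-1).
Proof.
move=> f0; move/subspace_continuousP => fc; apply/subspace_continuousP => t tI.
by apply: cvgV; [exact: f0|exact: fc].
Qed.

(* The value at [None] plays the role of the limit, which turns convergent
   sequences together with their limits into an algebra of functions. *)
Definition convergent_seq (f : option nat -> K) :=
  f (Some n) @[n --> \oo] --> f None.

Lemma convergent_algebra : fun_algebra setT convergent_seq.
Proof.
split.
- move=> f g fg; suff -> : f = g by [].
  by apply/funext => x; apply: fg; rewrite inE.
- by move=> c; exact: cvg_cst.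
- by move=> f g fc gc; exact: cvgD.
- by move=> f g fc gc; exact: cvgM.
Qed.

End FunAlgebraInstances.

(** * Global Picard theorem for bounded measurable coefficients *)

Section Picard.
Context {K : realType} {d : nat}.
Implicit Types (T a b c e k r s t : K) (f g h : K -> K) (X Y P : K -> 'M[K]_d)
  (F H : K -> 'M[K]_d -> 'M[K]_d) (G : 'M[K]_d).

Lemma geometric_cvg (u : nat -> K) c : 0 <= c ->
  (forall n, `|u n.+1 - u n| <= c / 2 ^+ n) ->
  (u @ \oo --> lim (u @ \oo)) /\ forall n, `|u n - u 0| <= 2 * c.
Proof.
move=> c0 uc.
(* [u - g] is nondecreasing and [g] tends to [0]. *)
pose g n : K := 2 * c / 2 ^+ n.
have gS n : g n.+1 = g n - c / 2 ^+ n by rewrite /g exprS; field; rewrite expf_neq0.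
have g_ge0 n : 0 <= g n by rewrite /g divr_ge0 ?exprn_ge0 ?mulr_ge0.
have g0 : g 0 = 2 * c by rewrite /g expr0 divr1.
have lo n : u n - u 0 <= g 0 - g n.
  elim: n => [|n IH]; first by rewrite !subrr.
  by have := uc n; rewrite gS ler_norml => /andP[_]; lra.
have hi n : u 0 - u n <= g 0 - g n.
  elim: n => [|n IH]; first by rewrite !subrr.
  by have := uc n; rewrite gS ler_norml => /andP[+ _]; lra.
split; last first.
  move=> n; rewrite ler_norml -g0; apply/andP; split.
    by have := hi n; have := g_ge0 n; lra.
  by have := lo n; have := g_ge0 n; lra.
have gcvg : g @ \oo --> 0.
  have -> : g = (fun n => 2 * c * (2^-1) ^+ n).
    by apply/funext => n; rewrite /g exprVn.
  rewrite -[X in _ --> X](mulr0 (2 * c)).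
  by apply: cvgM; [exact: cvg_cst|apply: cvg_expr; rewrite gtr0_norm ?invf_lt1 ?ltr1n].
have vcvg : cvgn (fun n => u n - g n).
  apply: nondecreasing_is_cvgn.
    apply/nondecreasing_seqP => n.
    by have := uc n; rewrite gS ler_norml => /andP[+ _]; lra.
  exists (u 0 + g 0) => _ [n _ <-]; have := lo n; have := g_ge0 n; lra.
suff : cvgn u by [].
have -> : u = (fun n => (u n - g n) + g n) by apply/funext => n; rewrite subrK.
by apply: is_cvgD => //; apply/cvg_ex; exists 0.
Qed.

(** On [[0, T]] this is [a] plus the integral of [h] from [t] to [T]: the integral form of
    [x' = - h], [x(T) = a]. *)
Definition backward_primitive T a h t := a + (primitive T h T - primitive T h t).

Lemma primitive_eq T h1 h2 : (forall s, s \in `[0, T] -> h1 s = h2 s) ->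
  primitive T h1 = primitive T h2.
Proof.
move=> h12; suff E : h1 \_ `[0, T] = h2 \_ `[0, T].
  by apply/funext => t; rewrite /primitive E.
apply/funext => t; rewrite !patchE; case: ifPn => // /set_mem; exact: h12.
Qed.

Lemma backward_primitiveT T a h : backward_primitive T a h T = a.
Proof. by rewrite /backward_primitive subrr addr0. Qed.

Lemma ac_deriv_backward T a h c : 0 <= T -> bounded_measurable T h c ->
  ac_deriv T (backward_primitive T a h) (fun t => - h t).
Proof.
move=> T0 hc.
have := ac_derivD (ac_deriv_cst T (a + primitive T h T))
  (ac_derivZ (-1) (ac_deriv_primitive T0 hc)).
rewrite /ac_deriv /backward_primitive.
under eq_fun do rewrite mulN1r -addrA.
by under [X in ae_on _ (fun t => is_derive t _ _ (X t))]eq_fun do rewrite mulN1r add0r.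
Qed.

Lemma backward_primitive_lipschitz T a h c : 0 <= T -> bounded_measurable T h c ->
  forall s t, 0 <= s -> s <= t -> t <= T ->
  `|backward_primitive T a h t - backward_primitive T a h s| <= c * (t - s).
Proof.
move=> T0 hc s t s0 st _; have := primitive_lipschitz T0 hc s0 st.
by rewrite distrC /backward_primitive; congr (`|_| <= _); ring.
Qed.

Lemma abs_continuous_continuous_on T f : abs_continuous T f -> continuous_on T f.
Proof.
move=> fA.
apply/subspace_continuousP => t tI; apply/cvgrPdist_lt => e e0.
have [r r0 rP] := abs_continuous_within fA tI e0.
rewrite near_withinE; apply/nbhs_ballP; exists r => // s; rewrite /ball /= distrC => sr sI.
by rewrite distrC; exact: rP.
Qed.

(** The limit passage shared by the Picard and the Kleinman schemes: the left side converges by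
    hypothesis, the right side by dominated convergence with the constant [c]. *)
Lemma limit_backward T a h (h_ : nat -> K -> K) (x_ : nat -> K -> K) c x t : 0 <= T ->
  (forall n, bounded_measurable T (h_ n) c) ->
  (forall s, s \in `[0, T] -> h_ n s @[n --> \oo] --> h s) ->
  (forall n, x_ n.+1 t = backward_primitive T a (h_ n) t) ->
  (x_ n t @[n --> \oo] --> x) ->
  bounded_measurable T h c /\ x = backward_primitive T a h t.
Proof.
move=> T0 hc hh xE xx.
have [hb hT] := primitive_cvg T T0 hc hh; have [_ ht] := primitive_cvg t T0 hc hh.
split => //.
have c1 : x_ n.+1 t @[n --> \oo] --> backward_primitive T a h t.
  under eq_fun do rewrite xE.
  by apply: cvgD; [exact: cvg_cst|exact: cvgB].
have c2 : x_ n.+1 t @[n --> \oo] --> x by rewrite (cvg_shiftS (x_ ^~ t)).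
exact: cvg_unique c2 c1.
Qed.

(** The integral form of [P' = - H(t, P)], [P(T) = G], with the bound that gives the integral its
    meaning. The identity is asked at every real [t], so that it rewrites [P] as a function. *)
Definition backward_solution T H G P := forall i j,
  exists2 c, bounded_measurable T (fun s => H s (P s) i j) c &
    forall t, P t i j = backward_primitive T (G i j) (fun s => H s (P s) i j) t.

Lemma backward_solution_ac T H G P : 0 <= T -> backward_solution T H G P ->
  mx_ac_deriv T P (fun t => - H t (P t)).
Proof.
move=> T0 HP i j; have [c hc PE] := HP i j.
under eq_fun do rewrite PE; under [X in ac_deriv _ _ X]eq_fun do rewrite mxE.
exact: ac_deriv_backward hc.
Qed.

Lemma backward_solutionT T H G P : backward_solution T H G P -> P T = G.
Proof.
move=> HP; apply/matrixP => i j; have [c _ ->] := HP i j.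
by rewrite backward_primitiveT.
Qed.

Lemma mx_ac_deriv_continuous T X X' : mx_ac_deriv T X X' -> mx_in (continuous_on T) X.
Proof. by move=> XX i j; apply: abs_continuous_continuous_on; case: (XX i j). Qed.

(** A pointwise limit is controlled on [[0, T]] only. The integral formula depends on these values
    alone, so it redefines the function elsewhere without changing the equation. *)
Lemma backward_solution_ext T H G X : 
  (forall i j, exists2 c, bounded_measurable T (fun s => H s (X s) i j) c &
    forall t, t \in `[0, T] ->
      X t i j = backward_primitive T (G i j) (fun s => H s (X s) i j) t) ->
  exists2 P, backward_solution T H G P & forall t, t \in `[0, T] -> P t = X t.
Proof.
move=> HX.
pose P t := \matrix_(i, j) backward_primitive T (G i j) (fun s => H s (X s) i j) t.
have PX t : t \in `[0, T] -> P t = X t.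
  by move=> tI; apply/matrixP => i j; rewrite mxE; have [c _ ->] := HX i j.
exists P => // i j; have [c [hm hb] _] := HX i j; exists c.
  split; first by apply: eq_measurable_fun hm => s /set_mem sI; rewrite PX.
  by move=> s sI; rewrite PX // hb.
move=> t; rewrite mxE /backward_primitive.
by rewrite (@primitive_eq T (fun s => H s (X s) i j) (fun s => H s (P s) i j)) // => s sI;
  rewrite PX.
Qed.

Lemma picard T F G c k : 0 <= T -> 0 < k ->
  (forall X, mx_in (measurable_on T) X -> mx_in (measurable_on T) (fun t => F t (X t))) ->
  (forall t (M N : 'M[K]_d) b, t \in `[0, T] -> (forall i j, `|M i j - N i j| <= b) ->
    forall i j, `|F t M i j - F t N i j| <= k * b) ->
  (forall t i j, t \in `[0, T] -> `|F t 0 i j| <= c) ->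
  (forall t (M : 'M[K]_d), t \in `[0, T] -> M^T = M -> (F t M)^T = F t M) -> G^T = G ->
  exists2 P, backward_solution T F G P & forall t, (P t)^T = P t.
Proof.
move=> T0 k0 Fm Flip Fc Fsym Gs.
pose step X t := \matrix_(i, j) backward_primitive T (G i j) (fun s => F s (X s) i j) t.
pose X_ n := iter n step (fun=> G).
have T_I : T \in `[0, T] by rewrite in_itv /= T0 lexx.
have Fbound X b : (forall t, t \in `[0, T] -> forall i j, `|X t i j| <= b) ->
    forall t, t \in `[0, T] -> forall i j, `|F t (X t) i j| <= k * b + c.
  move=> Xb t tI i j; have := Flip t (X t) 0 b tI; have := Fc t i j tI.
  have Hb i' j' : `|X t i' j' - (0 : 'M[K]_d) i' j'| <= b by rewrite mxE subr0 Xb.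
  move=> F0 /(_ Hb i j) FX.
  rewrite -[F t (X t) i j](subrK (F t 0 i j)).
  by rewrite (le_trans (ler_normD _ _)) // lerD.
have stepP X b : mx_in (measurable_on T) X ->
    (forall t, t \in `[0, T] -> forall i j, `|X t i j| <= b) ->
    (forall i j, bounded_measurable T (fun s => F s (X s) i j) (k * b + c)) /\
    mx_in (measurable_on T) (step X) /\
    exists b', forall t, t \in `[0, T] -> forall i j, `|step X t i j| <= b'.
  move=> Xm Xb.
  have hb i j : bounded_measurable T (fun s => F s (X s) i j) (k * b + c).
    by split; [exact: Fm|move=> t tI; exact: Fbound].
  split=> //; have sc i j : continuous_on T (fun t => step X t i j).
    apply/abs_continuous_continuous_on/(@lipschitz_abs_continuous _ _ _ _ (k * b + c)).
    move=> s t s0 st tT; rewrite !mxE.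
    exact: (backward_primitive_lipschitz _ T0 (hb i j)).
  split; first by move=> i j; exact: continuous_on_measurable.
  have [b' _ sb'] := mx_bounded_uniform (fun i j => continuous_on_bounded T0 (sc i j)).
  by exists b'.
have XP n : mx_in (measurable_on T) (X_ n) /\
    exists b, forall t, t \in `[0, T] -> forall i j, `|X_ n t i j| <= b.
  elim: n => [|n [mX [b bX]]]; last by have [_ []] := stepP _ _ mX bX.
  split; first exact: (mx_in_cst (measurable_algebra T)).
  by have [b _ Gb] := mx_entries_bounded G; exists b.
have XS n t i j : X_ n.+1 t i j =
    backward_primitive T (G i j) (fun s => F s (X_ n s) i j) t.
  by rewrite /X_ /= mxE.
have Xac n : mx_ac_deriv T (X_ n.+1) (fun t => - F t (X_ n t)).
  move=> i j; have [mX [b bX]] := XP n; have [hb _] := stepP _ _ mX bX.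
  under eq_fun do rewrite XS; under [X in ac_deriv _ _ X]eq_fun do rewrite mxE.
  exact: ac_deriv_backward (hb i j).
have XT n : X_ n T = G.
  case: n => [//|n]; apply/matrixP => i j.
  by rewrite XS backward_primitiveT.
have bp_sym (H : K -> 'M[K]_d) : (forall s, s \in `[0, T] -> (H s)^T = H s) -> forall t i j,
    backward_primitive T (G i j) (fun s => H s i j) t =
    backward_primitive T (G j i) (fun s => H s j i) t.
  move=> Hs t i j; rewrite -{1}Gs mxE /backward_primitive.
  rewrite (@primitive_eq T (fun s => H s i j) (fun s => H s j i)) // => s sI.
  by rewrite -{1}Hs // mxE.
have Xsym n t : (X_ n t)^T = X_ n t.
  elim: n t => [t //|n IH t]; apply/matrixP => i j; rewrite mxE !XS.
  by apply: bp_sym => s sI; rewrite Fsym.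
(* In the norm weighted by [w] the Picard map contracts by a factor [1/2]. *)
pose w t := expR (2 * k * (T - t)).
have wd := ac_deriv_expR T (2 * k).
have w1 t : t \in `[0, T] -> 1 <= w t.
  by rewrite in_itv /= => /andP[_ tT]; rewrite -expR0 ler_expR !mulr_ge0 ?subr_ge0 // ltW.
have w0 t : t \in `[0, T] -> w t <= w 0.
  rewrite in_itv /= => /andP[t0 tT]; rewrite ler_expR.
  apply: ler_wpM2l; first by rewrite mulr_ge0 // ltW.
  by rewrite lerD2l lerN2.
have [_ [B1 B1P]] := XP 1%N.
have [B2 B20 B2P] := mx_entries_bounded G.
pose B := `|B1| + B2.
have B0 : 0 <= B by rewrite addr_ge0 // ltW.
have diffP n t : t \in `[0, T] -> forall i j,
    `|X_ n.+1 t i j - X_ n t i j| <= B / 2 ^+ n * w t.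
  elim: n t => [|n IH] t tI i j.
    rewrite expr0 divr1 (le_trans (_ : _ <= B)) ?ler_peMr ?w1 //.
    rewrite (le_trans (ler_normB _ _)) // lerD //.
    by rewrite (le_trans (B1P t tI i j)) ?ler_norm.
  have t0 : 0 <= t by move: tI; rewrite in_itv /= => /andP[].
  have tT : t <= T by move: tI; rewrite in_itv /= => /andP[].
  have yd := ac_derivB (Xac n.+1 i j) (Xac n i j).
  have zd := ac_derivZ (B / 2 ^+ n.+1) wd.
  have Fd s : s \in `[0, T] -> `|F s (X_ n.+1 s) i j - F s (X_ n s) i j| <=
      B / 2 ^+ n.+1 * (2 * k * w s).
    move=> sI; rewrite (le_trans (Flip s _ _ _ sI (IH s sI) i j)) //.
    by rewrite exprS le_eqVlt; apply/orP; left; apply/eqP; field; rewrite expf_neq0.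
  (* Integration from [t] to [T]: the difference of two iterates vanishes at [T], and its
     derivative, like that of its opposite, stays above the derivative of the weighted bound. *)
  have lo := ac_deriv_cmp zd yd t0 tT (lexx T).
  have hi := ac_deriv_cmp zd (ac_derivZ (-1) yd) t0 tT (lexx T).
  have w_T : w T = 1 by rewrite /w subrr mulr0 expR0.
  have z_ge0 : 0 <= B / 2 ^+ n.+1 by rewrite divr_ge0 ?exprn_ge0.
  rewrite !XT -/(w T) -/(w t) w_T in lo hi.
  have {}lo : B / 2 ^+ n.+1 * 1 - B / 2 ^+ n.+1 * w t <=
      G i j - G i j - (X_ n.+2 t i j - X_ n.+1 t i j).
    apply: lo; apply: ae_onT => s sI _; have := Fd s sI.
    by rewrite ler_norml -/(w s) !mxE => /andP[_]; lra.
  have {}hi : B / 2 ^+ n.+1 * 1 - B / 2 ^+ n.+1 * w t <=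
      -1 * (G i j - G i j) - -1 * (X_ n.+2 t i j - X_ n.+1 t i j).
    apply: hi; apply: ae_onT => s sI _; have := Fd s sI.
    by rewrite ler_norml -/(w s) !mxE => /andP[+ _]; lra.
  rewrite ler_norml; apply/andP; split; lra.
have W0 : 0 <= B * w 0 by rewrite mulr_ge0 // expR_ge0.
have geo t i j : t \in `[0, T] ->
    (X_ n t i j @[n --> \oo] --> lim (X_ n t i j @[n --> \oo])) /\
    forall n, `|X_ n t i j - X_ 0%N t i j| <= 2 * (B * w 0).
  move=> tI; apply: (@geometric_cvg (fun n => X_ n t i j)) => // n.
  rewrite (le_trans (diffP n t tI i j)) // mulrAC.
  by rewrite ler_wpM2r ?invr_ge0 ?exprn_ge0 // ler_wpM2l // w0.
pose X t := \matrix_(i, j) lim (X_ n t i j @[n --> \oo]).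
have Xlim t i j : t \in `[0, T] -> X_ n t i j @[n --> \oo] --> X t i j.
  by move=> tI; rewrite mxE; exact: (geo t i j tI).1.
have Xb n t : t \in `[0, T] -> forall i j, `|X_ n t i j| <= 2 * (B * w 0) + B2.
  move=> tI i j; rewrite -[X_ n t i j](subrK (X_ 0%N t i j)).
  by rewrite (le_trans (ler_normD _ _)) // lerD //; exact: (geo t i j tI).2.
have hb n i j := (stepP _ _ (XP n).1 (Xb n)).1 i j.
have Xsym' t : (X t)^T = X t.
  by apply/matrixP => i j; rewrite !mxE; under eq_fun do rewrite -Xsym mxE.
have FX s i j : s \in `[0, T] -> F s (X_ n s) i j @[n --> \oo] --> F s (X s) i j.
  move=> sI; pose b n := \sum_i \sum_j `|X_ n s i j - X s i j|.
  have b0 : b n @[n --> \oo] --> 0.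
    have -> : 0 = \sum_(i < d) \sum_(j < d) `|X s i j - X s i j|.
      by rewrite big1 // => i' _; rewrite big1 // => j' _; rewrite subrr normr0.
    apply: (cvg_big add_continuous) => i' _; apply: (cvg_big add_continuous) => j' _.
    by apply: cvg_norm; apply: cvgB; [exact: Xlim|exact: cvg_cst].
  have bP n i' j' : `|X_ n s i' j' - X s i' j'| <= b n.
    rewrite /b (bigD1 i') //= (bigD1 j') //= -addrA lerDl.
    by rewrite addr_ge0 ?sumr_ge0 // => i'' _; rewrite sumr_ge0.
  have kb0 : k * b n @[n --> \oo] --> 0.
    by rewrite -(mulr0 k); apply: cvgM => //; exact: cvg_cst.
  apply/cvgrPdist_le => e e0.
  move/cvgrPdist_le : kb0 => /(_ e e0); apply: filterS => n /=.
  rewrite sub0r normrN => kbe; rewrite distrC.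
  by rewrite (le_trans (Flip s _ _ _ sI (bP n) i j)) // (le_trans (ler_norm _)).
have lim i j t : t \in `[0, T] ->
    bounded_measurable T (fun s => F s (X s) i j) (k * (2 * (B * w 0) + B2) + c) /\
    X t i j = backward_primitive T (G i j) (fun s => F s (X s) i j) t.
  move=> tI; apply: (@limit_backward T (G i j) (fun s => F s (X s) i j)
    (fun n s => F s (X_ n s) i j) (fun n s => X_ n s i j)) => //.
  - by move=> s sI; exact: FX.
  - exact: Xlim.
have [|P HP PX] := @backward_solution_ext T F G X.
  move=> i j; exists (k * (2 * (B * w 0) + B2) + c); first exact: (lim i j T T_I).1.
  by move=> t tI; exact: (lim i j t tI).2.
exists P => // t; apply/matrixP => i j; rewrite mxE.
have [_ _ ->] := HP j i; have [_ _ ->] := HP i j.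
by apply: bp_sym => s sI; rewrite Fsym // PX.
Qed.

End Picard.

(** * Kleinman iteration *)

Section AlgebraClosure.
Context {K : realType} {d : nat} {U : Type} {E : set U} {S : (U -> K) -> Prop}.
Context (AS : fun_algebra E S).
Implicit Types (A B C D Q R L X : U -> 'M[K]_d).

Lemma mx_in_lyapunov A C X : mx_in S A -> mx_in S C -> mx_in S X ->
  mx_in S (fun u => lyapunov (A u) (C u) (X u)).
Proof.
move=> SA SC SX.
apply: (mx_in_add AS); last first.
  by apply: (mx_in_mul AS) => //; apply: (mx_in_mul AS) => //; apply: (mx_in_tr AS).
by apply: (mx_in_add AS); apply: (mx_in_mul AS) => //; apply: (mx_in_tr AS).
Qed.

Lemma mx_in_closed_loop A B C D Q R L X :
  mx_in S A -> mx_in S B -> mx_in S C -> mx_in S D -> mx_in S Q -> mx_in S R ->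
  mx_in S L -> mx_in S X ->
  mx_in S (fun u => closed_loop (A u) (B u) (C u) (D u) (Q u) (R u) (L u) (X u)).
Proof.
move=> SA SB SC SD SQ SR SL SX.
apply: (mx_in_add AS).
  apply: mx_in_lyapunov => //; apply: (mx_in_add AS) => //; exact: (mx_in_mul AS).
apply: (mx_in_add AS) => //; apply: (mx_in_mul AS) => //; apply: (mx_in_mul AS) => //.
exact: (mx_in_tr AS).
Qed.

Lemma mx_in_ric_weight D R X : mx_in S D -> mx_in S R -> mx_in S X ->
  mx_in S (fun u => ric_weight (D u) (R u) (X u)).
Proof.
move=> SD SR SX; apply: (mx_in_add AS) => //; apply: (mx_in_mul AS) => //.
by apply: (mx_in_mul AS) => //; exact: (mx_in_tr AS).
Qed.

Lemma mx_in_gain B C D R X :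
  mx_in S B -> mx_in S C -> mx_in S D -> mx_in S X ->
  mx_in S (fun u => invmx (ric_weight (D u) (R u) (X u))) ->
  mx_in S (fun u => gain (B u) (C u) (D u) (R u) (X u)).
Proof.
move=> SB SC SD SX SW.
apply: (mx_in_opp AS); apply: (mx_in_mul AS) => //; apply: (mx_in_tr AS).
apply: (mx_in_add AS); first exact: (mx_in_mul AS).
by apply: (mx_in_mul AS) => //; apply: (mx_in_mul AS) => //; exact: (mx_in_tr AS).
Qed.

End AlgebraClosure.

Section Kleinman.
Context {K : realType} {d : nat}.
Implicit Types (X Y L : K -> 'M[K]_d) (x : 'cV[K]_d) (t s : K).

Context {T : K} {A B C D Q R : K -> 'M[K]_d} {G : 'M[K]_d}.
Context {psi psi' : K -> K} {delta : K}.
Local Notation ham t := (hamiltonian (A t) (B t) (C t) (D t) (Q t) (R t)).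
Local Notation W t := (ric_weight (D t) (R t)).
Local Notation gn t := (gain (B t) (C t) (D t) (R t)).
Local Notation cl t := (closed_loop (A t) (B t) (C t) (D t) (Q t) (R t)).
Local Notation I := (`[0, T]%classic : set K).

Context (T0 : 0 <= T).
Context (mA : mx_in (measurable_on T) A) (bA : mx_in (bounded_on I) A).
Context (mB : mx_in (measurable_on T) B) (bB : mx_in (bounded_on I) B).
Context (mC : mx_in (measurable_on T) C) (bC : mx_in (bounded_on I) C).
Context (mQ : mx_in (measurable_on T) Q) (bQ : mx_in (bounded_on I) Q).
Context (cD : mx_in (continuous_on T) D) (cR : mx_in (continuous_on T) R).
Context (Qs : forall t, t \in `[0, T] -> (Q t)^T = Q t).
Context (Rs : forall t, t \in `[0, T] -> (R t)^T = R t) (Gs : G^T = G).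

Lemma mx_continuous_bounded X : mx_in (continuous_on T) X -> mx_in (bounded_on I) X.
Proof. by move=> cX i j; exact: continuous_on_bounded. Qed.

Lemma mx_continuous_measurable X : mx_in (continuous_on T) X -> mx_in (measurable_on T) X.
Proof. by move=> cX i j; exact: continuous_on_measurable. Qed.

Let bD := mx_continuous_bounded cD.
Let bR := mx_continuous_bounded cR.
Let mD := mx_continuous_measurable cD.
Let mR := mx_continuous_measurable cR.

(** Supersolution against subsolution under one common feedback: the terms in [Q] and [R] cancel in
    the difference, which leaves a homogeneous Lyapunov inequality with [U = A + B L] and
    [V = C + D L]. *)
Lemma comparison X X' Y Y' L : mx_ac_deriv T X X' -> mx_ac_deriv T Y Y' ->
  (forall t, t \in `[0, T] -> (X t)^T = X t) ->
  (forall t, t \in `[0, T] -> (Y t)^T = Y t) ->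
  mx_in (bounded_on I) L -> possemidefmx (X T - Y T) ->
  ae_on T (fun t => forall x, bil (X' t) x x <= - ham t (X t) x (L t *m x)) ->
  ae_on T (fun t => forall x, - bil (Y' t) x x <= ham t (Y t) x (L t *m x)) ->
  forall t, t \in `[0, T] -> possemidefmx (X t - Y t).
Proof.
move=> XX YY Xs Ys bL XYT Xle Yle.
have AB := @bounded_algebra K K I.
have [c c0 Uc] := mx_bounded_uniform (mx_in_add AB bA (mx_in_mul AB bB bL)).
have [c' c'0 Vc] := mx_bounded_uniform (mx_in_add AB bC (mx_in_mul AB bD bL)).
apply: (@lyapunov_positive _ _ T (fun t => X t - Y t) (fun t => X' t - Y' t)
  (fun t => A t + B t *m L t) (fun t => C t + D t *m L t) (c + c')) => //.
- move=> i j; have := ac_derivB (XX i j) (YY i j).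
  by under [in X in _ -> X]eq_fun do rewrite !mxE;
    under [X in _ -> ac_deriv _ _ X]eq_fun do rewrite !mxE.
- by move=> t tI; rewrite linearB /= Xs // Ys.
- by apply: ae_onT => t tI i j; rewrite (le_trans (Uc t tI i j)) // lerDl.
- by apply: ae_onT => t tI i j; rewrite (le_trans (Vc t tI i j)) // lerDr.
apply: ae_on_imp (ae_on_and Xle Yle) => t tI [Xt Yt] x.
have := Xt x; have := Yt x; rewrite /hamiltonian !bilBm !mulmxDl -!mulmxA.
lra.
Qed.

Context (psi_ac : ac_deriv T psi psi').
Context (psi_gt0 : forall t, t \in `[0, T] -> 0 < psi t).
Context (G_psi : possemidefmx (G - (psi T)%:M)).
Context (psi_sub : ae_on T (fun t => forall x (u : 'cV[K]_d),
  - psi' t * bil 1%:M x x <= ham t (psi t)%:M x u)).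
Context (delta_gt0 : 0 < delta).
Context (weight_ge : forall t (M : 'M[K]_d), t \in `[0, T] ->
  possemidefmx (M - (psi t)%:M) ->
  forall x, delta * bil 1%:M x x <= bil (W t M) x x).

(** The invariant of the iteration: the lower bound makes the weight coercive, and continuity makes
    the next gain measurable and bounded. *)
Definition admissible X :=
  [/\ mx_in (continuous_on T) X,
      forall t, t \in `[0, T] -> (X t)^T = X t &
      forall t, t \in `[0, T] -> possemidefmx (X t - (psi t)%:M)].

Lemma weight_sym t (M : 'M[K]_d) : t \in `[0, T] -> M^T = M -> (W t M)^T = W t M.
Proof.
by move=> tI Ms; rewrite /ric_weight linearD /= Rs // !trmx_mul trmxK Ms mulmxA.
Qed.

Lemma weight_posdef t (M : 'M[K]_d) : t \in `[0, T] -> M^T = M ->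
  possemidefmx (M - (psi t)%:M) -> posdefmx (W t M).
Proof.
move=> tI Ms Mpsi; apply: coercive_posdef (weight_sym tI Ms) delta_gt0 _.
exact: weight_ge.
Qed.

Lemma psd_above_psi t (M : 'M[K]_d) : t \in `[0, T] ->
  M^T = M -> possemidefmx (M - (psi t)%:M) -> possemidefmx M.
Proof.
move=> tI Ms Mpsi; split; first exact/symmetricmxP.
move=> x; rewrite -/(bil M x x); have := psd_ge0 x Mpsi; rewrite bilBm (bil_scalar (psi t)).
have : 0 <= psi t * bil 1%:M x x by rewrite mulr_ge0 ?bil1_ge0 // ltW // psi_gt0.
lra.
Qed.

(** The index type is free so that pairs of an iterate and a time can be used: as the inverse weight
    is bounded through [delta] alone, one constant serves all iterates at once. *)
Lemma gain_bounded (U : Type) (E : set U) (tau : U -> K) (X : U -> 'M[K]_d) :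
  (forall u, E u -> tau u \in `[0, T]) ->
  mx_in (bounded_on E) X -> (forall u, E u -> (X u)^T = X u) ->
  (forall u, E u -> possemidefmx (X u - (psi (tau u))%:M)) ->
  mx_in (bounded_on E) (fun u => gn (tau u) (X u)).
Proof.
move=> tauI bX Xs Xpsi.
have comp (M : K -> 'M[K]_d) : mx_in (bounded_on I) M ->
    mx_in (bounded_on E) (fun u => M (tau u)).
  by move=> bM i j; have [c Mc] := bM i j; exists c => u /tauI; exact: Mc.
apply: (mx_in_gain (bounded_algebra E)) => //; try exact: comp.
move=> i j; exists delta^-1 => u Eu.
apply: coercive_invmx_bound => //.
  by apply: posdef_unitmx; apply: weight_posdef; rewrite ?tauI ?Xs //; exact: Xpsi.
by apply: weight_ge; [exact: tauI|exact: Xpsi].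
Qed.

Lemma ric_weight_inv_continuous X : mx_in (continuous_on T) X ->
  (forall t, t \in `[0, T] -> W t (X t) \in unitmx) ->
  mx_in (continuous_on T) (fun t => invmx (W t (X t))).
Proof.
move=> cX Wu; have AC := continuous_algebra T.
have cW := mx_in_ric_weight AC cD cR cX.
apply: (mx_in_inv AC) => //; apply: continuous_on_inv (fa_det AC cW) => t tI.
by rewrite -unitfE; exact: Wu.
Qed.

Lemma gain_measurable X : mx_in (continuous_on T) X ->
  (forall t, t \in `[0, T] -> W t (X t) \in unitmx) ->
  mx_in (measurable_on T) (fun t => gn t (X t)).
Proof.
move=> cX Wu; apply: (mx_in_gain (measurable_algebra T)) => //.
  exact: mx_continuous_measurable.
apply: mx_continuous_measurable; exact: ric_weight_inv_continuous.
Qed.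

(** Here compactness of [[0, T]] replaces the coercivity constant. Uniqueness relies on this form,
    since a given solution is not known to lie above [psi I]. *)
Lemma gain_bounded_cont X : mx_in (continuous_on T) X ->
  (forall t, t \in `[0, T] -> W t (X t) \in unitmx) ->
  mx_in (bounded_on I) (fun t => gn t (X t)).
Proof.
move=> cX Wu; apply: (mx_in_gain (@bounded_algebra K K I)) => //.
  exact: mx_continuous_bounded.
apply: mx_continuous_bounded; exact: ric_weight_inv_continuous.
Qed.

Lemma closed_loop_sym t (L M : 'M[K]_d) : t \in `[0, T] -> M^T = M ->
  (cl t L M)^T = cl t L M.
Proof.
move=> tI Ms; rewrite /closed_loop linearD /= lyapunov_sym // linearD /= Qs //.
by rewrite !trmx_mul trmxK Rs // mulmxA.
Qed.

Lemma closed_loop_solution L : mx_in (measurable_on T) L -> mx_in (bounded_on I) L ->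
  exists2 P, backward_solution T (fun t => cl t (L t)) G P & forall t, (P t)^T = P t.
Proof.
move=> mL bL.
have AM := measurable_algebra T; have AB := @bounded_algebra K K I.
have [a a0 Ua] := mx_bounded_uniform (mx_in_add AB bA (mx_in_mul AB bB bL)).
have [b b0 Vb] := mx_bounded_uniform (mx_in_add AB bC (mx_in_mul AB bD bL)).
have b_0 : mx_in (bounded_on I) (fun=> 0 : 'M[K]_d) by exact: (mx_in_cst AB).
have [c c0 Fc] := mx_bounded_uniform (mx_in_closed_loop AB bA bB bC bD bQ bR bL b_0).
(* One summand for each product in [lyapunov], by [mulmx_norm_le]; the last [1] makes [k]
   positive. *)
pose k := d%:R * a + d%:R * a + d%:R * (d%:R * (b * b)) + 1.
have k0 : 0 < k by rewrite ltr_wpDl // !addr_ge0 // !mulr_ge0.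
apply: (@picard _ _ T _ G c k) => //.
- by move=> X mX; apply: (mx_in_closed_loop AM).
- move=> t M N e tI MN i j.
  have e0 : 0 <= e by exact: le_trans (MN i j).
  have {}MN i' j' : `|(M - N) i' j'| <= e by rewrite !mxE; exact: MN.
  have -> : cl t (L t) M i j - cl t (L t) N i j =
      lyapunov (A t + B t *m L t) (C t + D t *m L t) (M - N) i j.
    rewrite /closed_loop /lyapunov !(mulmxBr, mulmxBl).
    set q := Q t + _; set x1 := _ *m M; set x2 := _ *m N; set x3 := M *m _; set x4 := N *m _.
    by rewrite !mxE; ring.
  have Ut i' j' : `|(A t + B t *m L t)^T i' j'| <= a by rewrite mxE; exact: Ua.
  have Vt i' j' : `|(C t + D t *m L t)^T i' j'| <= b by rewrite mxE; exact: Vb.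
  have h1 := mulmx_norm_le Ut MN i j.
  have h2 := mulmx_norm_le MN (Ua t tI) i j.
  have h3 := mulmx_norm_le (mulmx_norm_le Vt MN) (Vb t tI) i j.
  rewrite /lyapunov mxE [X in X + _]mxE.
  rewrite (le_trans (ler_normD _ _)) // (le_trans (lerD (ler_normD _ _) (lexx _))) //.
  apply: le_trans (lerD (lerD h1 h2) h3) _.
  by rewrite -subr_ge0 (_ : _ - _ = e) // /k; ring.
- by move=> t i j tI; exact: Fc.
- by move=> t M tI Ms; exact: closed_loop_sym.
Qed.

Lemma admissible_gain X : admissible X ->
  (forall t, t \in `[0, T] -> posdefmx (W t (X t))) /\
  mx_in (measurable_on T) (fun t => gn t (X t)) /\
  mx_in (bounded_on I) (fun t => gn t (X t)).
Proof.
move=> [cX Xs Xpsi].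
have Wp t : t \in `[0, T] -> posdefmx (W t (X t)).
  by move=> tI; apply: weight_posdef => //; [exact: Xs|exact: Xpsi].
have Wu t : t \in `[0, T] -> W t (X t) \in unitmx.
  by move=> tI; exact: posdef_unitmx (Wp t tI).
by split=> //; split; [exact: gain_measurable|exact: gain_bounded_cont].
Qed.

Lemma psi_scalar_ac : mx_ac_deriv T (fun t => (psi t)%:M) (fun t => (psi' t)%:M : 'M[K]_d).
Proof.
move=> i j; under eq_fun do rewrite mxE; under [X in ac_deriv _ _ X]eq_fun do rewrite mxE.
by case: (i == j) => //; exact: ac_deriv_cst.
Qed.

(** [psi_sub] holds for every control, in particular for the feedback that [X] provides; comparison
    with [psi I] then keeps the new iterate admissible. *)
Lemma kleinman_step X : admissible X -> exists2 P, admissible P &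
  backward_solution T (fun t => cl t (gn t (X t))) G P.
Proof.
move=> Xadm; have [Wp [mL bL]] := admissible_gain Xadm.
have [P HP Ps] := closed_loop_solution mL bL.
have Pac := backward_solution_ac T0 HP; have PT := backward_solutionT HP.
exists P => //; split => //; first exact: mx_ac_deriv_continuous Pac.
apply: (comparison Pac psi_scalar_ac _ _ bL) => //.
- by move=> t _; rewrite tr_scalar_mx.
- by rewrite PT.
- by apply: ae_onT => t tI x; rewrite bilNm bil_closed_loop.
- apply: ae_on_imp psi_sub => t tI H x.
  by rewrite (bil_scalar (psi' t)) -mulNr; exact: H.
Qed.

Lemma psi_admissible : admissible (fun t => (psi t)%:M).
Proof.
split.
- exact: mx_ac_deriv_continuous psi_scalar_ac.
- by move=> t _; rewrite tr_scalar_mx.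
- by move=> t _; rewrite subrr; exact: psd0.
Qed.

(** [P] solves its equation with the gain of [X]; its own gain minimizes the Hamiltonian, so [P] is
    a supersolution of the equation that [Y] solves. *)
Lemma kleinman_decreasing X P Y : admissible P -> admissible Y ->
  backward_solution T (fun t => cl t (gn t (X t))) G P ->
  backward_solution T (fun t => cl t (gn t (P t))) G Y ->
  forall t, t \in `[0, T] -> possemidefmx (P t - Y t).
Proof.
move=> Padm [_ Ys _] HP HY; have [Wp [_ bL]] := admissible_gain Padm.
case: Padm => _ Ps _.
apply: (comparison (backward_solution_ac T0 HP) (backward_solution_ac T0 HY) Ps Ys bL).
- by rewrite (backward_solutionT HP) (backward_solutionT HY) subrr; exact: psd0.
- apply: ae_onT => t tI x; rewrite bilNm bil_closed_loop ?Ps // lerN2.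
  by apply: gain_minimizes; [exact: Ps|exact: Rs|exact: Wp].
- by apply: ae_onT => t tI x; rewrite bilNm opprK bil_closed_loop ?Ys.
Qed.

Lemma kleinman_sequence : exists P_ : nat -> K -> 'M[K]_d,
  [/\ forall n, admissible (P_ n),
      forall n, backward_solution T (fun t => cl t (gn t (P_ n t))) G (P_ n.+1) &
      forall n t, t \in `[0, T] -> possemidefmx (P_ n.+1 t - P_ n.+2 t)].
Proof.
pose next (X : {X | admissible X}) : {X | admissible X} :=
  let H := cid2 (kleinman_step (svalP X)) in exist _ (s2val H) (s2valP H).
have nextP (Z : {X | admissible X}) :
    backward_solution T (fun t => cl t (gn t (sval Z t))) G (sval (next Z)).
  exact: s2valP'.
pose P_ n := iter n next (exist _ _ psi_admissible).
exists (fun n => sval (P_ n)); split => [n|n|n t tI].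
- exact: svalP.
- exact: nextP.
- apply: (kleinman_decreasing (svalP (P_ n.+1)) (svalP (P_ n.+2))) => //;
  exact: nextP.
Qed.

Lemma riccati_backward_solution : exists P,
  [/\ backward_solution T
        (fun t => riccati (A t) (B t) (C t) (D t) (Q t) (R t)) G P,
      forall t, t \in `[0, T] -> (P t)^T = P t &
      forall t, t \in `[0, T] -> posdefmx (W t (P t))].
Proof.
have [P_ [Padm PS Pdec]] := kleinman_sequence.
pose p n := P_ n.+1.
have psym n t : t \in `[0, T] -> (p n t)^T = p n t by case: (Padm n.+1) => _ + _; exact.
have ppsi n t : t \in `[0, T] -> possemidefmx (p n t - (psi t)%:M).
  by case: (Padm n.+1) => _ _; exact.
have p_psd n t : t \in `[0, T] -> possemidefmx (p n t).
  by move=> tI; apply: psd_above_psi (ppsi n t tI) => //; exact: psym.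
have pdec t x n : t \in `[0, T] -> bil (p n.+1 t) x x <= bil (p n t) x x.
  by move=> tI; have := psd_ge0 x (Pdec n t tI); rewrite bilBm subr_ge0.
have p0 t x n : t \in `[0, T] -> bil (p n t) x x <= bil (p 0%N t) x x.
  by move=> tI; elim: n => // n; apply: le_trans; exact: pdec.
have [b b0 pb] : exists2 c, 0 <= c & forall u, (`[0, T]%classic : set K) u ->
    forall i j, `|p 0%N u i j| <= c.
  by apply/mx_bounded_uniform/mx_continuous_bounded; case: (Padm 1%N).
(* The iterates are positive semidefinite with decreasing diagonals, so the first one bounds all
   entries. *)
have pbound n t : t \in `[0, T] -> forall i j, `|p n t i j| <= b.
  move=> tI i j; apply: psd_entry_le (p_psd n t tI) _ => k.
  rewrite -bil_delta (le_trans (p0 t _ n tI)) // bil_delta.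
  exact: le_trans (ler_norm _) (pb t tI k k).
have bil_cvg t x : t \in `[0, T] -> cvgn (fun n => bil (p n t) x x).
  move=> tI; apply: nonincreasing_is_cvgn.
    by apply/nonincreasing_seqP => n; exact: pdec.
  by exists 0 => _ [n _ <-]; exact: psd_ge0 (p_psd n t tI).
pose X t := \matrix_(i, j) lim (p n t i j @[n --> \oo]).
have p_cvg t i j : t \in `[0, T] -> p n t i j @[n --> \oo] --> X t i j.
  move=> tI; rewrite mxE; suff : cvgn (fun n => p n t i j) by [].
  (* Monotonicity concerns quadratic forms only; polarization passes convergence on to the
     entries. *)
  rewrite (_ : (fun n => p n t i j) = (fun n => 2^-1 *
     (bil (p n t) (delta_mx i ord0 + delta_mx j ord0) (delta_mx i ord0 + delta_mx j ord0)
     - bil (p n t) (delta_mx i ord0) (delta_mx i ord0)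
     - bil (p n t) (delta_mx j ord0) (delta_mx j ord0)))); last first.
    by apply/funext => n; rewrite -polarization // psym.
  apply: is_cvgM; first exact: is_cvg_cst.
  by apply: is_cvgB; [apply: is_cvgB|]; exact: bil_cvg.
pose ext (q : nat -> K -> 'M[K]_d) t (o : option nat) := if o is Some n then q n t else X t.
have AC := @convergent_algebra K.
have ext_cvg t : t \in `[0, T] -> mx_in convergent_seq (ext p t).
  by move=> tI i j; exact: p_cvg.
have ext1_cvg t : t \in `[0, T] -> mx_in convergent_seq (ext (fun n => p n.+1) t).
  move=> tI i j; rewrite /convergent_seq /=.
  by rewrite (cvg_shiftS (fun n => p n t i j)); exact: p_cvg.
have bil_ext t x y : t \in `[0, T] -> bil (p n t) x y @[n --> \oo] --> bil (X t) x y.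
  move=> tI; have Cx := mx_in_cst AC x^T; have Cy := mx_in_cst AC y.
  exact: (mx_in_mul AC (mx_in_mul AC Cx (ext_cvg t tI)) Cy ord0 ord0).
have Xsym t : t \in `[0, T] -> (X t)^T = X t.
  move=> tI; apply/matrixP => i j; rewrite !mxE.
  suff -> : (fun n => p n t j i) = (fun n => p n t i j) by [].
  by apply/funext => n; rewrite -[in RHS](psym n t tI) mxE.
have Xpsi t : t \in `[0, T] -> possemidefmx (X t - (psi t)%:M).
  move=> tI; split; first by apply/symmetricmxP; rewrite linearB /= tr_scalar_mx Xsym.
  move=> x; rewrite -/(bil (X t - _) x x) bilBm subr_ge0.
  apply: (cvgr_to_ge (bil_ext t x x tI)); exists 0%N => // n _ /=.
  by have := psd_ge0 x (ppsi n t tI); rewrite bilBm subr_ge0.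
have ext_weight t (o : option nat) : t \in `[0, T] -> posdefmx (W t (ext p t o)).
  move=> tI; case: o => [n|] /=; apply: weight_posdef => //.
  - exact: psym.
  - exact: ppsi.
  - exact: Xsym.
  - exact: Xpsi.
have gain_cvg t : t \in `[0, T] -> mx_in convergent_seq (fun o => gn t (ext p t o)).
  move=> tI; have cst (M : 'M[K]_d) := mx_in_cst AC M.
  apply: (mx_in_gain AC) => //; first exact: ext_cvg.
  have Wc := mx_in_ric_weight AC (cst (D t)) (cst (R t)) (ext_cvg t tI).
  have Wu o : W t (ext p t o) \in unitmx by exact: posdef_unitmx (ext_weight t o tI).
  apply: (mx_in_inv AC) => //.
  apply: cvgV; last exact: (fa_det AC Wc).
  by rewrite -unitfE; exact: Wu.
have h_cvg t i j : t \in `[0, T] ->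
    cl t (gn t (p n t)) (p n.+1 t) i j @[n --> \oo] --> cl t (gn t (X t)) (X t) i j.
  move=> tI; have cst (M : 'M[K]_d) := mx_in_cst AC M.
  exact: (mx_in_closed_loop AC (cst (A t)) (cst (B t)) (cst (C t)) (cst (D t))
    (cst (Q t)) (cst (R t)) (gain_cvg t tI) (ext1_cvg t tI) i j).
pose E : set (nat * K) := [set u | u.2 \in `[0, T]].
have AE := @bounded_algebra K _ E.
have comp (M : K -> 'M[K]_d) : mx_in (bounded_on I) M ->
    mx_in (bounded_on E) (fun u => M u.2).
  by move=> bM i j; have [c Mc] := bM i j; exists c => u; exact: Mc.
have pE : mx_in (bounded_on E) (fun u => p u.1 u.2).
  by move=> i j; exists b => u uE; exact: pbound.
have p1E : mx_in (bounded_on E) (fun u => p u.1.+1 u.2).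
  by move=> i j; exists b => u uE; exact: pbound.
have gE : mx_in (bounded_on E) (fun u => gn u.2 (p u.1 u.2)).
  apply: (@gain_bounded _ E snd) => //.
  - by move=> u uE; exact: psym.
  - by move=> u uE; exact: ppsi.
have hE := mx_in_closed_loop AE (comp _ bA) (comp _ bB) (comp _ bC) (comp _ bD)
  (comp _ bQ) (comp _ bR) gE p1E.
have hX i j : exists2 c, bounded_measurable T (fun s => cl s (gn s (X s)) (X s) i j) c &
    forall t, t \in `[0, T] ->
      X t i j = backward_primitive T (G i j) (fun s => cl s (gn s (X s)) (X s) i j) t.
  have [c hc] := hE i j.
  have hb n : bounded_measurable T (fun s => cl s (gn s (p n s)) (p n.+1 s) i j) c.
    have [c' [hm _] _] := PS n.+1 i j; split => // s sI.
    exact: (hc (n, s) sI).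
  have lim t : t \in `[0, T] ->
      bounded_measurable T (fun s => cl s (gn s (X s)) (X s) i j) c /\
      X t i j = backward_primitive T (G i j) (fun s => cl s (gn s (X s)) (X s) i j) t.
    move=> tI; apply: (@limit_backward K T (G i j) (fun s => cl s (gn s (X s)) (X s) i j)
      (fun n s => cl s (gn s (p n s)) (p n.+1 s) i j) (fun n s => p n s i j)) => //.
    - by move=> s sI; exact: h_cvg.
    - by move=> n; have [_ _ ->] := PS n.+1 i j.
    - exact: p_cvg.
  exists c; last by move=> t /lim[].
  by apply: (lim T _).1; rewrite in_itv /= T0 lexx.
have Wu t : t \in `[0, T] -> W t (X t) \in unitmx.
  by move=> tI; exact: posdef_unitmx (ext_weight t None tI).
(* The gain of index [n] and the matrix of index [n + 1] have limits built from the same [X], so the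
   limit carries its own gain and its closed loop is the Riccati operator. *)
have ric t : t \in `[0, T] -> cl t (gn t (X t)) (X t) =
    riccati (A t) (B t) (C t) (D t) (Q t) (R t) (X t).
  by move=> tI; rewrite riccati_closed_loop //; [exact: Xsym|exact: Rs|exact: Wu].
have [|P HP PX] := @backward_solution_ext _ _ T
    (fun t => riccati (A t) (B t) (C t) (D t) (Q t) (R t)) G X.
  move=> i j; have [c [hm hb] hX'] := hX i j; exists c.
    split; first by apply: eq_measurable_fun hm => s /set_mem sI; rewrite ric.
    by move=> s sI; rewrite -ric // hb.
  move=> t tI; rewrite hX' // /backward_primitive.
  by rewrite (@primitive_eq K T (fun s => cl s (gn s (X s)) (X s) i j)
    (fun s => riccati (A s) (B s) (C s) (D s) (Q s) (R s) (X s) i j)) // => s sI;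
    rewrite ric.
exists P; split => // t tI; rewrite PX //; first exact: Xsym.
exact: (ext_weight t None tI).
Qed.

(** The gain of [P1] is frozen: by [bil_riccati] the loss is zero for [P1] and a nonnegative
    weighted square for [P2], which is thus a subsolution. *)
Lemma riccati_le P1 P2 P1' P2' :
  mx_ac_deriv T P1 P1' -> mx_ac_deriv T P2 P2' -> P1 T = G -> P2 T = G ->
  (forall t, t \in `[0, T] -> (P1 t)^T = P1 t) ->
  (forall t, t \in `[0, T] -> (P2 t)^T = P2 t) ->
  (forall t, t \in `[0, T] -> posdefmx (W t (P1 t))) ->
  (forall t, t \in `[0, T] -> posdefmx (W t (P2 t))) ->
  ae_on T (fun t => P1' t = - riccati (A t) (B t) (C t) (D t) (Q t) (R t) (P1 t)) ->
  ae_on T (fun t => P2' t = - riccati (A t) (B t) (C t) (D t) (Q t) (R t) (P2 t)) ->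
  forall t, t \in `[0, T] -> possemidefmx (P1 t - P2 t).
Proof.
move=> ac1 ac2 T1 T2 s1 s2 w1 w2 e1 e2.
have u1 t : t \in `[0, T] -> W t (P1 t) \in unitmx by move=> /w1/posdef_unitmx.
have u2 t : t \in `[0, T] -> W t (P2 t) \in unitmx by move=> /w2/posdef_unitmx.
have bL := gain_bounded_cont (mx_ac_deriv_continuous ac1) u1.
apply: (comparison ac1 ac2 s1 s2 bL).
- by rewrite T1 T2 subrr; exact: psd0.
- apply: ae_on_imp e1 => t tI -> x; rewrite bilNm lerN2.
  rewrite (bil_riccati (A t) _ (C t) _ x (gn t (P1 t) *m x));
    [|exact: s1|exact: Rs|exact: u1].
  by rewrite subrr bil0l subr0.
- apply: ae_on_imp e2 => t tI -> x; rewrite bilNm opprK.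
  rewrite (bil_riccati (A t) _ (C t) _ x (gn t (P1 t) *m x));
    [|exact: s2|exact: Rs|exact: u2].
  by rewrite lerBlDr lerDl; apply: psd_ge0; apply: posdef_psd; exact: w2.
Qed.

Lemma riccati_unique P1 P2 P1' P2' :
  mx_ac_deriv T P1 P1' -> mx_ac_deriv T P2 P2' -> P1 T = G -> P2 T = G ->
  (forall t, t \in `[0, T] -> (P1 t)^T = P1 t) ->
  (forall t, t \in `[0, T] -> (P2 t)^T = P2 t) ->
  (forall t, t \in `[0, T] -> posdefmx (W t (P1 t))) ->
  (forall t, t \in `[0, T] -> posdefmx (W t (P2 t))) ->
  ae_on T (fun t => P1' t = - riccati (A t) (B t) (C t) (D t) (Q t) (R t) (P1 t)) ->
  ae_on T (fun t => P2' t = - riccati (A t) (B t) (C t) (D t) (Q t) (R t) (P2 t)) ->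
  forall t, t \in `[0, T] -> P1 t = P2 t.
Proof.
move=> ac1 ac2 T1 T2 s1 s2 w1 w2 e1 e2 t tI.
have d12 := riccati_le ac1 ac2 T1 T2 s1 s2 w1 w2 e1 e2 tI.
have d21 := riccati_le ac2 ac1 T2 T1 s2 s1 w2 w1 e2 e1 tI.
apply/matrixP => i j; rewrite (polarization i j (s1 t tI)) (polarization i j (s2 t tI)).
have E x : bil (P1 t) x x = bil (P2 t) x x.
  by have := psd_ge0 x d12; have := psd_ge0 x d21; rewrite !bilBm => *; lra.
by rewrite !E.
Qed.

End Kleinman.

(** * Transfer to the original problem *)

Section Transfer.
Context {K : realType} {d : nat}.
Implicit Types (T : K) (P M X : K -> 'M[K]_d).
Implicit Types (F H : K -> 'M[K]_d -> 'M[K]_d) (G : 'M[K]_d).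

Lemma mx_entry_norm_le (M : 'M[K]_d) i j : `|M i j| <= `|M|.
Proof.
rewrite [leRHS]/Num.Def.normr /= mx_normrE.
exact: (le_bigmax _ (fun ij : 'I_d * 'I_d => `|M ij.1 ij.2|) (i, j)).
Qed.

Lemma mx_norm_le (M : 'M[K]_d) c : 0 <= c -> (forall i j, `|M i j| <= c) -> `|M| <= c.
Proof.
by move=> c0 Mc; rewrite [leLHS]/Num.Def.normr /= mx_normrE; apply: bigmax_le.
Qed.

(** Two right-hand sides appear because the integral equation is solved for the coefficients
    modified on a null set, while the ODE concerns the given ones. *)
Lemma backward_solution_ode T F H G P : 0 <= T -> backward_solution T H G P ->
  ae_on T (fun t => H t (P t) = F t (P t)) -> ode_solution T F G P.
Proof.
move=> T0 HP HF; split; last exact: backward_solutionT HP.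
- pose c i j := sval (cid2 (HP i j)).
  apply: (@lipschitz_abs_continuous _ _ _ _ (\sum_i \sum_j `|c i j|)) => s t s0 st tT.
  have ts0 : 0 <= t - s by rewrite subr_ge0.
  have S0 : 0 <= \sum_i \sum_j `|c i j|.
    by rewrite sumr_ge0 // => i _; rewrite sumr_ge0.
  apply: mx_norm_le; first by rewrite mulr_ge0.
  move=> i j; apply: (@le_trans _ _ (`|c i j| * (t - s))).
    rewrite /c; case: cid2 => b /= hb PE; rewrite !mxE !PE.
    apply: le_trans (backward_primitive_lipschitz _ T0 hb s0 st tT) _.
    by rewrite ler_wpM2r // ler_norm.
  rewrite ler_wpM2r // (bigD1 i) //= (bigD1 j) //= -addrA lerDl.
  by rewrite addr_ge0 ?sumr_ge0 // => i' _; rewrite sumr_ge0.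
- have Pac := backward_solution_ac T0 HP.
  have Pd : ae_on T (fun t => forall ij : 'I_d * 'I_d,
      is_derive t 1 (fun t => P t ij.1 ij.2) ((- H t (P t)) ij.1 ij.2)).
    by apply: ae_on_all => ij; exact: (Pac ij.1 ij.2).2.
  apply: ae_on_imp (ae_on_and Pd HF) => t tI [Pt Ht].
  have dP : derivable P t 1.
    by apply/derivable_mxP => i j; exact: (@ex_derive _ _ _ _ _ _ _ (Pt (i, j))).
  split => //; rewrite derive_mx // -Ht; apply/matrixP => i j; rewrite !mxE.
  by rewrite (@derive_val _ _ _ _ _ _ _ (Pt (i, j))) mxE addNr.
Qed.

Lemma ode_solution_ac T F G P : ode_solution T F G P ->
  mx_ac_deriv T P (fun t => - F t (P t)).
Proof.
move=> [PA PD _] i j; split.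
  move=> e e0; have [r r0 rP] := PA e e0; exists r => // n a b ab tI lr.
  apply: le_lt_trans (rP n a b ab tI lr); apply: ler_sum => k _.
  by have := mx_entry_norm_le (P (b k) - P (a k)) i j; rewrite !mxE.
apply: ae_on_imp PD => t tI [dP DP].
have dPij : derivable (fun t => P t i j) t 1 by exact: (derivable_mxP _ _ _).1 dP i j.
apply: DeriveDef => //.
have := DP; rewrite derive_mx // => /matrixP/(_ i j); rewrite !mxE => /eqP.
by rewrite addr_eq0 => /eqP.
Qed.

Lemma mx_continuous_entries T M : {within `[0, T], continuous M} ->
  mx_in (continuous_on T) M.
Proof.
move=> cM i j t.
exact: (cvg_comp _ _ (cM t) (@coord_continuous _ _ _ i j (M t))).
Qed.

End Transfer.

(** * Modification on a null set and uniform coercivity of the weight *)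

Section Regularization.
Context {K : realType} {d : nat}.
Implicit Types (T c : K) (M D R : K -> 'M[K]_d) (N : set K).

(* Setting the coefficients to [0] on a measurable null set makes the almost
   everywhere bounds and the symmetry of [Q] hold everywhere. *)
Definition vanish_on N M t : 'M[K]_d := \1_(~` N) t *: M t.

Lemma vanish_onE N M t : ~ N t -> vanish_on N M t = M t.
Proof. by move=> Nt; rewrite /vanish_on indicE mem_set // scale1r. Qed.

Lemma vanish_on_measurable T N M : measurable N ->
  (forall i j, measurable_fun `[0, T] (fun t => M t i j)) ->
  mx_in (measurable_on T) (vanish_on N M).
Proof.
move=> mN mM; apply: (mx_in_scale (measurable_algebra T)) => //.
by apply: measurable_indic; exact: measurableC.
Qed.

Lemma vanish_on_bounded T N M c :
  (forall t, t \in `[0, T] -> ~ N t -> forall i j, `|M t i j| <= c) ->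
  mx_in (bounded_on (`[0, T]%classic : set K)) (vanish_on N M).
Proof.
move=> Mc i j; exists `|c| => t tI; rewrite mxE indicE.
have [Nt|Nt] := pselect (N t).
  by rewrite memNset ?mul0r ?normr0 //; apply.
by rewrite mem_set // mul1r (le_trans (Mc t tI Nt i j)) // ler_norm.
Qed.

(* The hypothesis gives [R + D^T X D >= (1 - a) psi D^T D], and [D^-1] is bounded
   by continuity. *)
Lemma weight_coercive T D R (psi : K -> K) a m : 0 <= T -> 0 < m -> a < 1 ->
  mx_in (continuous_on T) D -> (forall t, t \in `[0, T] -> D t \in unitmx) ->
  (forall t, t \in `[0, T] -> m <= psi t) ->
  (forall t, t \in `[0, T] -> loewner_le (- (a * psi t *: ((D t)^T *m D t))) (R t)) ->
  exists2 e, 0 < e & forall t (X : 'M[K]_d), t \in `[0, T] ->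
    possemidefmx (X - (psi t)%:M) ->
    forall x, e * bil 1%:M x x <= bil (ric_weight (D t) (R t) X) x x.
Proof.
move=> T0 m0 a1 cD Du psi_m RD.
have AC := continuous_algebra T.
have cDi : mx_in (continuous_on T) (fun t => invmx (D t)).
  apply: (mx_in_inv AC) => //; apply: continuous_on_inv (fa_det AC cD) => t tI.
  by rewrite -unitfE; exact: Du.
have [c c0 Dc] := mx_bounded_uniform (mx_continuous_bounded T0 cDi).
(* [bil1_mulmx_le] for [D^-1] gives [|x|^2 <= k |D x|^2]; the [+ 1] makes [k] positive. *)
pose k := d%:R * (c * c) * d%:R * 2 + 1.
have k0 : 0 < k by rewrite ltr_wpDl // !mulr_ge0.
have b0 : 0 < 1 - a by rewrite subr_gt0.
exists ((1 - a) * m / k); first by rewrite divr_gt0 // mulr_gt0.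
move=> t X tI Xpsi x.
have xD : bil 1%:M x x <= k * bil 1%:M (D t *m x) (D t *m x).
  have := bil1_mulmx_le (D t *m x) (Dc t tI).
  rewrite mulKmx ?Du // /k; have := bil1_ge0 (D t *m x); lra.
have := psd_ge0 x (RD t tI); have := psd_ge0 (D t *m x) Xpsi.
rewrite opprK /ric_weight bilBm (bil_scalar (psi t)) !bilDm bilZm bil_congr bilMl.
rewrite [bil (D t) _ _]bil1r.
have y0 := bil1_ge0 (D t *m x).
have mpsi : (1 - a) * m * bil 1%:M (D t *m x) (D t *m x) <=
    (1 - a) * psi t * bil 1%:M (D t *m x) (D t *m x).
  by rewrite ler_wpM2r // ler_wpM2l ?psi_m // ltW.
have : (1 - a) * m / k * bil 1%:M x x <= (1 - a) * m * bil 1%:M (D t *m x) (D t *m x).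
  rewrite -!mulrA ler_wpM2l ?(ltW b0) // ler_wpM2l ?(ltW m0) //.
  by rewrite ler_pdivrMl.
lra.
Qed.

End Regularization.

Theorem theorem1p1 (K : realType) (T : K) (d : nat)
    (A B C D Q R : K -> 'M[K]_d) (G : 'M[K]_d)
    (T_gt0 : 0 < T) (d_ge1 : (1 <= d)%N)
    (A_Linfty : Linfty_mx T A) (B_Linfty : Linfty_mx T B)
    (C_Linfty : Linfty_mx T C) (Q_Linfty : Linfty_mx T Q)
    (Q_sym : ae_on T (fun t => Q t \is symmetricmx))
    (G_sym : G \is symmetricmx)
    (D_cont : {within `[0, T], continuous D})
    (R_cont : {within `[0, T], continuous R})
    (R_sym : forall t, t \in `[0, T] -> R t \is symmetricmx)
    (D_unit : forall t, t \in `[0, T] -> D t \in unitmx)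
    (G_gt0 : posdefmx G)
    (cond : exists (alpha : K) (phi : K -> K),
        [/\ 0 < alpha, alpha < 1,
            phi_solution T A B C D Q G alpha phi,
            forall t, t \in `[0, T] -> 0 < phi t &
            forall t, t \in `[0, T] ->
              loewner_le (- (phi t *: ((D t)^T *m D t))) (R t)]) :
  exists P : K -> 'M[K]_d,
    riccati_solution T A B C D Q R G P /\
    forall P' : K -> 'M[K]_d, riccati_solution T A B C D Q R G P' ->
      forall t, t \in `[0, T] -> P' t = P t.
Proof.
have T0 : 0 <= T := ltW T_gt0.
have TI : T \in `[0, T] by rewrite in_itv /= T0 lexx.
case: cond => alpha [phi [a0 a1 [phiA phiD phiT] phi_gt0 phiR]].
case: A_Linfty => mA [cA bA]; case: B_Linfty => mB [cB bB].
case: C_Linfty => mC [cC bC]; case: Q_Linfty => mQ [cQ bQ].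
have good := ae_on_and bA (ae_on_and bB (ae_on_and bC (ae_on_and bQ Q_sym))).
(* The almost-everywhere quantifier supplies a measurable null set containing all exceptional times
   of [[0, T]]; its measurability is what [vanish_on_measurable] asks. *)
have [N [mN N0 goodN]] := good.
have {}goodN t : t \in `[0, T] -> ~ N t ->
    [/\ forall i j, `|A t i j| <= cA, forall i j, `|B t i j| <= cB,
        forall i j, `|C t i j| <= cC, forall i j, `|Q t i j| <= cQ &
        Q t \is symmetricmx].
  move=> tI Nt.
  suff [? [? [? [? ?]]]] : (forall i j, `|A t i j| <= cA) /\ (forall i j, `|B t i j| <= cB) /\
    (forall i j, `|C t i j| <= cC) /\ (forall i j, `|Q t i j| <= cQ) /\
    Q t \is symmetricmx by [].
  by apply: contrapT => H; apply/Nt/goodN => /= /(_ tI).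
have aeN : ae_on T (fun t => ~ N t).
  by exists N; split => // t /= H; apply: contrapT => Nt; apply: H.
pose A0 := vanish_on N A; pose B0 := vanish_on N B.
pose C0 := vanish_on N C; pose Q0 := vanish_on N Q.
have mA0 := vanish_on_measurable mN mA; have mB0 := vanish_on_measurable mN mB.
have mC0 := vanish_on_measurable mN mC; have mQ0 := vanish_on_measurable mN mQ.
have bA0 : mx_in (bounded_on (`[0, T]%classic : set K)) A0.
  by apply: (@vanish_on_bounded _ _ T N A cA) => t tI /(goodN t tI)[].
have bB0 : mx_in (bounded_on (`[0, T]%classic : set K)) B0.
  by apply: (@vanish_on_bounded _ _ T N B cB) => t tI /(goodN t tI)[].
have bC0 : mx_in (bounded_on (`[0, T]%classic : set K)) C0.
  by apply: (@vanish_on_bounded _ _ T N C cC) => t tI /(goodN t tI)[].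
have bQ0 : mx_in (bounded_on (`[0, T]%classic : set K)) Q0.
  by apply: (@vanish_on_bounded _ _ T N Q cQ) => t tI /(goodN t tI)[].
have Q0s t : t \in `[0, T] -> (Q0 t)^T = Q0 t.
  move=> tI; rewrite /Q0 /vanish_on linearZ /= indicE.
  have [Nt|Nt] := pselect (N t); first by rewrite memNset ?scale0r //; apply.
  by have [_ _ _ _ /symmetricmxP ->] := goodN t tI Nt.
have Rs t : t \in `[0, T] -> (R t)^T = R t by move=> /R_sym/symmetricmxP.
have Gs : G^T = G by exact/symmetricmxP.
have cD := mx_continuous_entries D_cont; have cR := mx_continuous_entries R_cont.
pose rhs t := riccati (A t) (B t) (C t) (D t) (Q t) (R t).
pose rhs0 t := riccati (A0 t) (B0 t) (C0 t) (D t) (Q0 t) (R t).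
have rhsE : ae_on T (fun t => forall X, rhs0 t X = rhs t X).
  apply: ae_on_imp aeN => t tI Nt X.
  by rewrite /rhs0 /A0 /B0 /C0 /Q0 !vanish_onE.
(* Division by [alpha] removes it from the source term and from the terminal value: [psi T] is the
   least eigenvalue of [G], whence [psi T I <= G]. *)
pose psi t := alpha^-1 * phi t.
pose phi' t := - (lambda_alpha A B C D alpha t * phi t + alpha * min_eigenvalue (Q t)).
pose psi' t := alpha^-1 * phi' t.
have phi_ac : ac_deriv T phi phi'.
  split => //; apply: ae_on_imp phiD => t tI [dphi Dphi].
  by apply: DeriveDef => //; apply/eqP; rewrite -addr_eq0 Dphi.
have psi_ac : ac_deriv T psi psi' := ac_derivZ alpha^-1 phi_ac.
have a_psi t : alpha * psi t = phi t by rewrite /psi mulVKf // gt_eqF.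
have psi_gt0 t : t \in `[0, T] -> 0 < psi t.
  by move=> tI; rewrite mulr_gt0 ?invr_gt0 ?phi_gt0.
have psi_R t : t \in `[0, T] -> loewner_le (- (alpha * psi t *: ((D t)^T *m D t))) (R t).
  by move=> tI; rewrite a_psi; exact: phiR.
have [m m0 psi_m] : exists2 m, 0 < m & forall t, t \in `[0, T] -> m <= psi t.
  have cpsi : continuous_on T psi.
    (* Continuity of [psi] is read off a diagonal entry of [psi I], which exists because
       [d >= 1]. *)
    have := mx_ac_deriv_continuous (psi_scalar_ac (d := d) psi_ac).
    by move=> /(_ (Ordinal d_ge1) (Ordinal d_ge1)); under eq_fun do rewrite mxE eqxx.
  have [t tI tmin] := EVT_min T0 cpsi.
  by exists (psi t); [exact: psi_gt0|].
have [e e0 We] := weight_coercive T0 m0 a1 cD D_unit psi_m psi_R.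
have G_psi : possemidefmx (G - (psi T)%:M).
  split; first by apply/symmetricmxP; rewrite linearB /= tr_scalar_mx Gs.
  move=> x; rewrite -/(bil (G - _) x x) bilBm (bil_scalar (psi T)) subr_ge0.
  by rewrite /psi phiT mulKf ?gt_eqF //; exact: min_eigenvalue_le.
have psi_sub : ae_on T (fun t => forall x (u : 'cV[K]_d), - psi' t * bil 1%:M x x <=
    hamiltonian (A0 t) (B0 t) (C0 t) (D t) (Q0 t) (R t) (psi t)%:M x u).
  apply: ae_on_imp aeN => t tI Nt x u; rewrite /A0 /B0 /C0 /Q0 !vanish_onE //.
  have [_ _ _ _ /symmetricmxP Qt] := goodN t tI Nt.
  have := subsolution_hamiltonian (A t) (B t) (C t) x u d_ge1 a0 a1
    (ltW (psi_gt0 t tI)) (D_unit t tI) Qt (psi_R t tI).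
  have -> : - psi' t = lambda_alpha A B C D alpha t * psi t + min_eigenvalue (Q t).
    by rewrite /psi' /phi' /psi; field; rewrite gt_eqF.
  by [].
have [P [HP Ps Pw]] := riccati_backward_solution T0 mA0 bA0 mB0 bB0 mC0 bC0 mQ0 bQ0
  cD cR Q0s Rs Gs psi_ac psi_gt0 G_psi psi_sub e0 We.
have Psol : ode_solution T rhs G P.
  by apply: backward_solution_ode T0 HP _; apply: ae_on_imp rhsE => t _; exact.
have rhs_ae X : ae_on T (fun t => - rhs t (X t) = - rhs0 t (X t)).
  by apply: ae_on_imp rhsE => t _ ->.
exists P; split; first by split => // t tI; apply/symmetricmxP; exact: Ps.
move=> P' [P's P'sol P'w] t tI.
have [_ _ P'T] := P'sol; have [_ _ PT] := Psol.
(* Both solve the equation with the given coefficients; [rhs_ae] turns it, almost everywhere, into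
   the one with the modified coefficients, for which the comparison was proved. *)
apply: (riccati_unique (Q := Q0) T0 bA0 bB0 bC0 cD cR Rs (ode_solution_ac P'sol)
  (ode_solution_ac Psol) P'T PT _ Ps P'w Pw (rhs_ae P') (rhs_ae P)) => // s.
by move=> /P's/symmetricmxP.
Qed.
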